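(* Let $A=\mathbb{C}[x,y,z]$, let $s,t\in A\setminus\{0\}$ be coprime and equip $A$ with the Poisson bracket determined by $\{x,y\}=t s_z-s t_z$, $\{y,z\}=t s_x-s t_x$, $\{z,x\}=t s_y-s t_y$ (subscripts denote partial derivatives). For $(\lambda,\mu)\in\mathbb{P}^1(\mathbb{C})$ put $f_{\lambda,\mu}=\lambda s-\mu t$. Then the Poisson primitive ideals of $A$ are exactly: (i) the Poisson maximal ideals, namely the maximal ideals $\langle x-\alpha,y-\beta,z-\gamma\rangle$ such that either $p=(\alpha,\beta,\gamma)$ is a common zero of $s$ and $t$, or $p$ is a singular point of $f_{\lambda,\mu}$ for some $(\lambda,\mu)\in\mathbb{P}^1(\mathbb{C})$; and (ii) the ideals $uA$ where $u$ is an irreducible factor, of multiplicity one, of $f_{\lambda,\mu}$ for some $(\lambda,\mu)\in\mathbb{P}^1(\mathbb{C})$ for which $f_{\lambda,\mu}$ is a non-zero non-unit. Moreover $A$ satisfies the Poisson Dixmier–Moeglin equivalence.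
   Context: A Poisson ideal is an ideal $I$ with $\{a,I\}\subseteq I$ for all $a$; a Poisson prime ideal is a Poisson ideal that is prime. The Poisson core of an ideal $I$ is the largest Poisson ideal contained in $I$; a Poisson prime ideal is Poisson primitive if it is the Poisson core of a maximal ideal. A Poisson maximal ideal is a maximal ideal that is a Poisson ideal. A Poisson prime $P$ is locally closed if it is not the intersection of the Poisson prime ideals strictly containing it, and rational if the Poisson centre of the quotient field $Q(A/P)$ (with the induced bracket) is $\mathbb{C}$. The Poisson Dixmier–Moeglin equivalence means that for Poisson prime ideals, locally closed, Poisson primitive and rational are equivalent. A point $p$ is a singular point of a polynomial $f$ if $f(p)=0$ and $f_x(p)=f_y(p)=f_z(p)=0$. $(\lambda,\mu)\in\mathbb{P}^1(\mathbb{C})$ means $(\lambda,\mu)\in\mathbb{C}^2\setminus\{0\}$ up to nonzero scalar. *)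

(* Defs.v *)
From HB Require Import structures.
From mathcomp Require Import all_boot all_order all_algebra.
From mathcomp Require Import complex.
From mathcomp Require Import reals.
From mathcomp Require Import mpoly.
Set Implicit Arguments. Unset Strict Implicit. Unset Printing Implicit Defensive.
Import Order.TTheory GRing.Theory Num.Theory.
Local Open Scope ring_scope.

Section PoissonDefs.
Variable C : comNzRingType.
Local Notation A := {mpoly C[3]}.

Definition ix : 'I_3 := @Ordinal 3 0 isT.
Definition iy : 'I_3 := @Ordinal 3 1 isT.
Definition iz : 'I_3 := @Ordinal 3 2 isT.

Definition Px : A := 'X_ix.
Definition Py : A := 'X_iy.
Definition Pz : A := 'X_iz.

Definition dx (a : A) : A := a^`M(ix).
Definition dy (a : A) : A := a^`M(iy).
Definition dz (a : A) : A := a^`M(iz).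

(* The biderivation with {x,y} = c_z, {y,z} = c_x, {z,x} = c_y,
   where c_i = t s_i - s t_i; i.e. {a,b} = sum_{i,j} a_i b_j {x_i,x_j}. *)
Definition cx (s t : A) : A := t * dx s - s * dx t.
Definition cy (s t : A) : A := t * dy s - s * dy t.
Definition cz (s t : A) : A := t * dz s - s * dz t.

Definition pbr (s t : A) (a b : A) : A :=
    dx a * dy b * cz s t - dy a * dx b * cz s t
  + dy a * dz b * cx s t - dz a * dy b * cx s t
  + dz a * dx b * cy s t - dx a * dz b * cy s t.

Definition mdvd (d a : A) : Prop := exists q : A, a = q * d.
Definition munit (u : A) : Prop := exists v : A, u * v = 1.
Definition mcoprime (s t : A) : Prop :=
  forall d : A, mdvd d s -> mdvd d t -> munit d.
Definition mirreducible (u : A) : Prop :=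
  u <> 0 /\ ~ munit u /\ forall a b : A, u = a * b -> munit a \/ munit b.
Definition simple_irr_factor (u f : A) : Prop :=
  mirreducible u /\ mdvd u f /\ ~ mdvd (u * u) f.

Definition ideal (I : A -> Prop) : Prop :=
  I 0 /\ (forall a b, I a -> I b -> I (a + b)) /\ (forall a b, I b -> I (a * b)).
Definition proper (I : A -> Prop) : Prop := ~ I 1.
Definition subI (I J : A -> Prop) : Prop := forall a, I a -> J a.
Definition eqI (I J : A -> Prop) : Prop := forall a, I a <-> J a.
Definition prime_ideal (I : A -> Prop) : Prop :=
  ideal I /\ proper I /\ (forall a b, I (a * b) -> I a \/ I b).
Definition maximal_ideal (I : A -> Prop) : Prop :=
  ideal I /\ proper I /\
  (forall J, ideal J -> proper J -> subI I J -> subI J I).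

Variables s t : A.
Local Notation "{ a , b }" := (pbr s t a b).

Definition poisson_ideal (I : A -> Prop) : Prop :=
  ideal I /\ forall a b, I b -> I {a, b}.
Definition poisson_prime (I : A -> Prop) : Prop :=
  poisson_ideal I /\ prime_ideal I.
Definition poisson_maximal (I : A -> Prop) : Prop :=
  maximal_ideal I /\ poisson_ideal I.
Definition is_poisson_core (I P : A -> Prop) : Prop :=
  poisson_ideal P /\ subI P I /\
  (forall J, poisson_ideal J -> subI J I -> subI J P).
Definition poisson_primitive (P : A -> Prop) : Prop :=
  poisson_prime P /\ exists M, maximal_ideal M /\ is_poisson_core M P.
Definition locally_closed (P : A -> Prop) : Prop :=
  ~ eqI P (fun a => forall Q, poisson_prime Q -> subI P Q -> ~ subI Q P -> Q a).
(* The Poisson centre of Q(A/P) is C.  An element of Q(A/P) is a class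
   a/b with b notin P; the induced bracket is {a/b, c/d} computed by the
   quotient rule, so a/b is Poisson central iff
   b{a,c} - a{b,c} = 0 in A/P for all c in A, and a/b lies in C iff
   a - lambda b = 0 in A/P for some lambda in C. *)
Definition poisson_rational (P : A -> Prop) : Prop :=
  forall a b : A, ~ P b ->
    (forall c : A, P (b * {a, c} - a * {b, c})) ->
    exists lam : C, P (a - lam%:MP * b).

End PoissonDefs.

Definition pt_ideal (C : comNzRingType) (al be ga : C) (a : {mpoly C[3]}) : Prop :=
  exists q1 q2 q3 : {mpoly C[3]},
    a = q1 * (Px C - al%:MP) + q2 * (Py C - be%:MP) + q3 * (Pz C - ga%:MP).

Definition pt (C : comNzRingType) (al be ga : C) : 'I_3 -> C :=
  fun i => nth 0 [:: al; be; ga] i.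

Definition is_singular_point (C : comNzRingType) (f : {mpoly C[3]}) (al be ga : C) : Prop :=
  f.@[pt al be ga] = 0 /\ (dx f).@[pt al be ga] = 0 /\
  (dy f).@[pt al be ga] = 0 /\ (dz f).@[pt al be ga] = 0.

(* Main.v *)
Require Import Defs.
From HB Require Import structures.
From mathcomp Require Import all_boot all_order all_algebra.
From mathcomp Require Import complex reals mpoly.
From mathcomp Require Import boolp ring.
Import Order.TTheory GRing.Theory Num.Theory.
Local Open Scope ring_scope.
Set Implicit Arguments. Unset Strict Implicit. Unset Printing Implicit Defensive.

(* Write c = t grad s - s grad t. For f = lam s - mu t one has
   lam c = t grad f - f grad t and mu c = s grad f - f grad s, so {a, f} is in
   fA, and a point is Poisson exactly when c vanishes there.

   Locally closed => primitive: a prime is an intersection of maximal ideals,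
   and in characteristic 0 the Poisson core of a maximal ideal is prime.
   Primitive => rational: if a/b is Poisson central modulo the core P of M, its
   denominators form a Poisson ideal not inside M, so a/b has a value lam at M,
   and the Poisson ideal of numerators of (a - lam b)/b lies in M, hence in P.
   Rational => (i) or (ii): s/t is Poisson central, so P contains some f, and
   then an irreducible factor u of f if f <> 0. If f = 0, if u^2 divides f, or if
   P is larger than uA (so that any two coordinates are algebraically dependent
   modulo P), the bracket vanishes modulo P and rationality makes P maximal.
   (i) or (ii) => locally closed: Poisson primes larger than uA contain c, while
   uA does not when u is a simple factor. *)

(** * Factorial rings *)

Section Divisibility.
Variable D : comNzRingType.
Implicit Types a b u p : D.

Definition rdvd d a := exists q, a = q * d.
Definition runit u := exists v, u * v = 1.
Definition rirreducible u :=
  u <> 0 /\ ~ runit u /\ forall a b, u = a * b -> runit a \/ runit b.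
Definition rprime u :=
  u <> 0 /\ ~ runit u /\ forall a b, rdvd u (a * b) -> rdvd u a \/ rdvd u b.

(* Existence of factorizations is encoded by an additive length. *)
Definition factorial_ring :=
  (exists l : D -> nat,
     (forall a b, a != 0 -> b != 0 -> l (a * b) = (l a + l b)%N) /\
     (forall a, a != 0 -> l a = 0%N <-> runit a)) /\
  (forall u, rirreducible u -> rprime u).

Lemma rdvdD d a b : rdvd d a -> rdvd d b -> rdvd d (a + b).
Proof. by move=> [p ->] [q ->]; exists (p + q); rewrite mulrDl. Qed.

Lemma rdvdN d a : rdvd d a -> rdvd d (- a).
Proof. by move=> [p ->]; exists (- p); rewrite mulNr. Qed.

Lemma rdvd_mull d a b : rdvd d b -> rdvd d (a * b).
Proof. by move=> [q ->]; exists (a * q); rewrite mulrA. Qed.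

Lemma rdvd_mulr d a b : rdvd d a -> rdvd d (a * b).
Proof. by rewrite mulrC; apply: rdvd_mull. Qed.

Lemma rdvdr0 d : rdvd d 0.
Proof. by exists 0; rewrite mul0r. Qed.

Lemma rdvd_refl d : rdvd d d.
Proof. by exists 1; rewrite mul1r. Qed.

Lemma rdvd1 d : rdvd d 1 <-> runit d.
Proof. by split=> -[q]; [move=> e; exists q | move=> <-; exists q]; rewrite mulrC. Qed.

Lemma rdvd_addr d a b : rdvd d a -> rdvd d (a + b) -> rdvd d b.
Proof. by move=> da dab; rewrite -[b](addKr a); apply: rdvdD => //; apply: rdvdN. Qed.

End Divisibility.

Section Factorial.
Variable D : idomainType.
Implicit Types a b u p : D.

Lemma rprime_irreducible p : rprime p -> rirreducible p.
Proof.
move=> [p0 [nu pP]]; split=> //; split=> // a b pE.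
have: rdvd p (a * b) by rewrite -pE; exact: rdvd_refl.
have p0' : p != 0 by apply/eqP.
case/pP=> -[q qE]; [right|left]; exists q; apply: (mulfI p0').
  by rewrite {2}pE qE; ring.
by rewrite {2}pE qE; ring.
Qed.

Hypothesis facD : factorial_ring D.

Lemma irreducible_factor a :
  a != 0 -> ~ runit a -> exists2 u, rirreducible u & rdvd u a.
Proof.
case: facD => -[l [lM l0]] _.
elim: (l a) {-2}a (leqnn (l a)) => {a} [|n IH] a la a0 nua.
  by case: nua; apply/l0 => //; apply/eqP; rewrite -leqn0.
have [ia|nia] := pselect (rirreducible a).
  by exists a => //; exact: rdvd_refl.
have : exists b c, [/\ a = b * c, ~ runit b & ~ runit c].
  apply: contrapT => H; apply: nia; split; first exact/eqP.
  split=> // b c aE; apply: contrapT => /not_orP[nb nc].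
  by apply: H; exists b, c.
move=> [b [c [aE nb nc]]].
have [b0 c0] : b != 0 /\ c != 0 by apply/andP; rewrite -negb_or -mulf_eq0 -aE.
have lc : (0 < l c)%N by rewrite lt0n; apply/eqP => /(l0 _ c0)/nc.
have lb : (l b <= n)%N.
  by rewrite -ltnS; apply: leq_trans la; rewrite aE lM // -addn1 leq_add2l.
have [u iu ub] := IH b lb b0 nb; exists u => //.
by rewrite aE; apply: rdvd_mulr.
Qed.

(** Allows nonzero elements to be built up one prime factor at a time, the additive length serving
    as induction measure. *)
Lemma factorial_ind (P : D -> Prop) :
  (forall a, runit a -> P a) ->
  (forall p a, rprime p -> a != 0 -> P a -> P (p * a)) ->
  forall a, a != 0 -> P a.
Proof.
move=> P1 PM; case: (facD) => -[l [lM l0]] prP a.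
elim: (l a) {-2}a (leqnn (l a)) => {a} [|n IH] a la a0.
  by apply/P1/l0 => //; apply/eqP; rewrite -leqn0.
have [ua|nua] := pselect (runit a); first exact: P1.
have [u iu [b aE]] := irreducible_factor a0 nua.
have pu := prP _ iu; move: (pu) => [/eqP u0 [nu _]].
have b0 : b != 0 by apply: contraNneq a0 => b0; rewrite aE b0 mul0r.
rewrite aE mulrC; apply: PM => //; apply: IH => //.
have lu : (0 < l u)%N by rewrite lt0n; apply/eqP => /(l0 _ u0)/nu.
by rewrite -ltnS; apply: leq_trans la; rewrite aE lM // -addn1 leq_add2l.
Qed.

End Factorial.

(** * Gauss's lemma: polynomials over a factorial domain *)

Section FactorialPoly.
Variable D : idomainType.
Implicit Types (c d : D) (f g h p q u v : {poly D}).

Lemma runit_size p : runit p -> size p = 1%N.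
Proof.
move=> [q pq]; have := congr1 (fun x : {poly D} => size x) pq.
have p0 : p != 0 by apply/eqP => E; move/eqP: pq; rewrite E mul0r eq_sym oner_eq0.
have q0 : q != 0 by apply/eqP => E; move/eqP: pq; rewrite E mulr0 eq_sym oner_eq0.
rewrite size_mul // size_poly1; rewrite -size_poly_gt0 in p0; rewrite -size_poly_gt0 in q0.
by case: (size p) (size q) p0 q0 => [|[|n]] [|m] //= _ _; rewrite addnS.
Qed.

Lemma runit_polyC c : runit c%:P <-> runit c.
Proof.
split=> [[q cq]|[d cd]]; last by exists d%:P; rewrite -polyCM cd.
by exists q`_0; rewrite -coefCM cq coef1.
Qed.
Lemma rdvd_polyMX c f : rdvd c%:P (f * 'X) -> rdvd c%:P f.
Proof.
move=> [q qE].
have q00 : c * q`_0 = 0 by rewrite mulrC -coefMC -qE coefMX.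
(* For [c = 0] the hypothesis forces [f = 0]; otherwise [q] has zero constant term and ['X] divides
   it. *)
have [c0|c0] := eqVneq c 0.
  exists 0; rewrite mul0r; apply/eqP; move/eqP: qE.
  by rewrite c0 mulr0 mulf_eq0 polyX_eq0 orbF.
have /factor_theorem[q' q'E] : root q 0.
  by rewrite /root horner_coef0; move/eqP: q00; rewrite mulf_eq0 (negPf c0).
exists q'; apply: (mulIf (negbT (polyX_eq0 D))).
by rewrite qE q'E polyC0 subr0 mulrAC.
Qed.

(** Induction on [f], then on [g]: a constant term divisible by [c] is dropped and a factor ['X]
    cancelled. When [c] does not divide the constant term of [f], it divides that of [g]. *)
Lemma rprime_polyC c : rprime c -> rprime c%:P.
Proof.
move=> [c0 [nu cP]]; split; first by move/eqP; rewrite polyC_eq0 => /eqP.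
split; first by move/runit_polyC.
have coefdvd f : rdvd c%:P f -> rdvd c f`_0.
  by move=> [q ->]; exists q`_0; rewrite coefMC.
have dvdC d : rdvd c d -> rdvd c%:P d%:P.
  by move=> [q ->]; exists q%:P; rewrite polyCM.
elim/poly_ind => [|f a IHf] g; first by left; exact: rdvdr0.
have [ca|nca] := pselect (rdvd c a).
  rewrite mulrDl => H.
  have {}H : rdvd c%:P (f * g * 'X).
    rewrite mulrAC; apply: rdvd_addr (rdvd_mulr g (dvdC _ ca)) _.
    by rewrite addrC.
  case: (IHf g (rdvd_polyMX H)) => ?; [left|by right].
  by apply: rdvdD (dvdC _ ca); apply: rdvd_mulr.
move=> H; right; elim/poly_ind: g H => [|g b IHg] H; first exact: rdvdr0.
have cb : rdvd c%:P b%:P.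
  have := coefdvd _ H; rewrite coef0M !coefD !coefMX !coefC !add0r /=.
  by case/cP => // ?; exact: dvdC.
apply: rdvdD (cb); apply/rdvd_mulr/IHg/rdvd_polyMX.
apply: (rdvd_addr (rdvd_mull (f * 'X + a%:P) cb)).
by rewrite -mulrA -mulrDr [b%:P + _]addrC.
Qed.

Lemma size1_polyC p : size p = 1%N -> exists2 c, c != 0 & p = c%:P.
Proof. by move/eqP/size_poly1P. Qed.

Hypothesis facD : factorial_ring D.

(* [p] plays the role of a primitive polynomial: nonzero constants can be
   cancelled modulo [p]. *)
Lemma rdvd_cancel p :
  (forall c, rprime c -> ~ rdvd c%:P p) ->
  forall r, r != 0 -> forall g, rdvd p (r%:P * g) -> rdvd p g.
Proof.
move=> pp; apply: factorial_ind => // [a [b ab]|c a pc a0 IH] g.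
  by move=> /(rdvd_mull b%:P); rewrite mulrA -polyCM mulrC [b * a]mulrC ab mulr1.
move=> [k kE]; have [_ [_ cP]] := rprime_polyC pc.
have : rdvd c%:P (k * p).
  by rewrite -kE polyCM -mulrA; apply/rdvd_mulr/rdvd_refl.
case/cP => [[k' k'E]|/(pp _ pc)//]; apply: IH; exists k'.
have c0 : c%:P != 0 by rewrite polyC_eq0; case: pc => /eqP.
by apply: (mulfI c0); rewrite mulrA -polyCM kE k'E; ring.
Qed.

(** Each prime factor of [c] stays prime in the polynomial ring, so it can be cancelled from [h] or
    from [q] without changing a degree. This turns a factorization over the fraction field into one
    over [D]. *)
Lemma rdvd_strip c : c != 0 -> forall p h q, p != 0 -> c%:P * p = h * q ->
  exists h' q', [/\ p = h' * q', size h' = size h & size q' = size q].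
Proof.
move: c; apply: (factorial_ind facD) => [a [b ab]|c a pc a0 IH] p h q p0 E.
  exists (b%:P * h), q; split=> //.
    by rewrite -mulrA -E mulrA -polyCM [b * a]mulrC ab mul1r.
  rewrite mul_polyC size_scale //.
  by apply/eqP => b0; move/eqP: ab; rewrite b0 mulr0 eq_sym oner_eq0.
have [/eqP c0 [_ cP]] := rprime_polyC pc.
have c0' : c != 0 by rewrite -polyC_eq0.
have : rdvd c%:P (h * q) by rewrite -E polyCM -mulrA; apply/rdvd_mulr/rdvd_refl.
case/cP => -[k kE].
  have [|h' [q' [pE sh sq]]] := IH p k q p0.
    by apply: (mulfI c0); rewrite mulrA -polyCM E kE; ring.
  by exists h', q'; split=> //; rewrite sh kE mulrC mul_polyC size_scale.
have [|h' [q' [pE sh sq]]] := IH p h k p0.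
  by apply: (mulfI c0); rewrite mulrA -polyCM E kE; ring.
by exists h', q'; split=> //; rewrite sq kE mulrC mul_polyC size_scale.
Qed.

(** The Bezout identity over the fraction field, with denominators cleared into the constant [r]. *)
Lemma Bezout_const p q : coprimep p q ->
  exists2 r, r != 0 & exists a b, r%:P = a * p + b * q.
Proof.
case/Bezout_coprimepP => -[a b] /= /eqpP[[c d] /= /andP[c0 d0] E].
exists d => //; exists (c%:P * a), (c%:P * b).
by rewrite -alg_polyC -E -mul_polyC mulrDr !mulrA.
Qed.

Lemma dvdp_const p q : p %| q ->
  exists2 c, c != 0 & exists k, c%:P * q = k * p.
Proof.
move/Pdiv.Idomain.dvdpP => [[c k] /= c0 E].
by exists c => //; exists k; rewrite mul_polyC.
Qed.

Lemma factorial_poly : factorial_ring {poly D}.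
Proof.
case: (facD) => -[l [lM l0]] irrP; split.
  (* The length of a polynomial is its degree plus the length of its leading coefficient. *)
  exists (fun p => (size p).-1 + l (lead_coef p))%N; split=> [p q p0 q0|p p0].
    rewrite lead_coefM lM ?lead_coef_eq0 // size_mul // addnACA; congr addn.
    move: p0 q0; rewrite -!size_poly_gt0.
    by case: (size p) (size q) => [|n] [|m] //= _ _; rewrite addnS.
  split=> [/eqP|up].
    rewrite addn_eq0 => /andP[sp /eqP]; move: sp p0.
    rewrite -size_poly_gt0; case sp: (size p) => [|[|]] // _ _.
    have [c c0 ->] := size1_polyC sp.
    by rewrite lead_coefC => /(l0 _ c0); rewrite runit_polyC.
  have sp := runit_size up; have [c c0 pE] := size1_polyC sp.
  rewrite sp pE lead_coefC; apply/l0 => //.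
  by move: up; rewrite pE runit_polyC.
move=> p [/eqP p0 [nup pP]].
have [sp|sp] := eqVneq (size p) 1%N.
  have [c c0 pE] := size1_polyC sp; rewrite pE.
  apply/rprime_polyC/irrP; split; first exact/eqP.
  split=> [uc|a b cE]; first by apply: nup; rewrite pE runit_polyC.
  by have := pP a%:P b%:P; rewrite -polyCM -cE !runit_polyC; exact.
(* A nonconstant irreducible polynomial is primitive, so constants can be cancelled modulo it. *)
have pp c : rprime c -> ~ rdvd c%:P p.
  move=> [c0 [nuc _]] [q qE]; case: (pP _ _ qE); last by rewrite runit_polyC.
  move/runit_size => sq; move/negP: sp; apply; apply/eqP.
  by rewrite qE mulrC mul_polyC size_scale //; apply/eqP.
split; first exact/eqP.
split=> // f g pfg.
(* If [p] and [f] are coprime over the fraction field, some [r%:P * g] with [r != 0] is a multiple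
   of [p]. Otherwise their gcd is [p] up to constants, because [p] is irreducible. *)
have [/Bezout_const[r r0 [a [b rE]]]|] := boolP (coprimep p f).
  right; apply: (rdvd_cancel pp r0); rewrite rE mulrDl; apply: rdvdD.
    by rewrite mulrAC; apply/rdvd_mull/rdvd_refl.
  by rewrite -mulrA; apply: rdvd_mull.
rewrite coprimep_def => sh; left; set h := gcdp p f in sh.
have [c c0 [k kE]] := dvdp_const (dvdp_gcdl p f).
have [c' c'0 [k' k'E]] := dvdp_const (dvdp_gcdr p f).
have [q [h' [pE sq sh']]] := rdvd_strip c0 p0 kE.
case: (pP _ _ pE) => [/runit_size|/runit_size/eqP]; last by rewrite sh' (negPf sh).
rewrite sq => /size1_polyC[d d0 kd].
apply: (rdvd_cancel pp (mulf_neq0 c'0 d0)); exists (k' * c%:P).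
by rewrite -mulrA kE kd polyCM mulrAC k'E; ring.
Qed.

(** If [u] and [v] had a nonconstant common factor over the fraction field, the prime [u] would
    divide it, hence a constant multiple of [v], hence that constant, which then serves as [r]. *)
Lemma rprime_elimination u v : rprime u -> ~ rdvd u v ->
  exists2 r, r != 0 & exists a b, r%:P = a * u + b * v.
Proof.
move=> [u0 [nu uP]] nuv.
have [/Bezout_const//|] := boolP (coprimep u v).
rewrite coprimep_def => sh; set h := gcdp u v in sh.
have [c c0 [k kE]] := dvdp_const (dvdp_gcdl u v).
have [c' c'0 [k' k'E]] := dvdp_const (dvdp_gcdr u v).
have : rdvd u (k * h) by rewrite -kE; apply/rdvd_mull/rdvd_refl.
case/uP => [[m mE]|uh].
  have /eqP u0' := u0; have {}kE : c%:P = m * h.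
    by apply: (mulIf u0'); rewrite kE mE mulrAC.
  have mh : m * h != 0 by rewrite -kE polyC_eq0.
  have := congr1 (fun x : {poly D} => size x) kE; rewrite size_polyC c0.
  move: mh; rewrite mulf_eq0 negb_or => /andP[m0 h0]; rewrite size_mul //.
  move: m0 h0 sh; rewrite -!size_poly_gt0.
  by case: (size m) (size h) => [|[|n]] [|[|k0]] //=; rewrite addnS.
have : rdvd u (c'%:P * v) by rewrite k'E; apply: rdvd_mull.
case/uP => // -[m mE].
by exists c' => //; exists m, 0; rewrite mul0r addr0.
Qed.

End FactorialPoly.

Lemma factorial_field (F : fieldType) : factorial_ring F.
Proof.
have unitF (a : F) : a != 0 -> runit a by move=> a0; exists a^-1; rewrite mulfV.
split; first by exists (fun=> 0%N); split=> // a a0; split=> // _; exact: unitF.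
by move=> u [/eqP u0 [nu _]]; case: nu; exact: unitF.
Qed.

(** * The Nullstellensatz *)

Definition eval_ext (D S : comNzRingType) (r : {rmorphism D -> S}) (x : S) :
    {rmorphism {poly D} -> S} :=
  GRing.RMorphism.clone _ _ (horner_eval x \o map_poly r) _.

Lemma eval_extC (D S : comNzRingType) (r : {rmorphism D -> S}) x c :
  eval_ext r x c%:P = r c.
Proof. by rewrite /= map_polyC horner_evalE hornerC. Qed.

Lemma eval_extX (D S : comNzRingType) (r : {rmorphism D -> S}) x :
  eval_ext r x 'X = x.
Proof. by rewrite /= map_polyX horner_evalE hornerX. Qed.

Section Nullstellensatz.

Definition ring_ideal (D : comNzRingType) (I : D -> Prop) :=
  I 0 /\ (forall a b, I a -> I b -> I (a + b)) /\ (forall a b, I b -> I (a * b)).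
Definition ring_prime (D : comNzRingType) (I : D -> Prop) :=
  ring_ideal I /\ ~ I 1 /\ (forall a b, I (a * b) -> I a \/ I b).

Lemma ideal_opp (D : comNzRingType) (I : D -> Prop) a : ring_ideal I -> I a -> I (- a).
Proof. by move=> [_ [_ IM]] /(IM (-1)); rewrite mulN1r. Qed.

Lemma ideal_sub (D : comNzRingType) (I : D -> Prop) a b :
  ring_ideal I -> I a -> I b -> I (a - b).
Proof. by move=> II Ia Ib; apply: II.2.1 => //; apply: ideal_opp. Qed.

Lemma ideal_mulr (D : comNzRingType) (I : D -> Prop) a b :
  ring_ideal I -> I a -> I (a * b).
Proof. by move=> II Ia; rewrite mulrC; apply: II.2.2. Qed.

Lemma ideal_addr (D : comNzRingType) (I : D -> Prop) a b :
  ring_ideal I -> I a -> I (a + b) -> I b.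
Proof. by move=> II Ia Iab; rewrite -[b](addKr a) addrC; apply: ideal_sub. Qed.

Lemma ideal_sum (D : comNzRingType) (I : D -> Prop) (J : Type) (r : seq J)
    (Q : pred J) (F : J -> D) :
  ring_ideal I -> (forall j, Q j -> I (F j)) -> I (\sum_(j <- r | Q j) F j).
Proof. by move=> [I0 [ID _]] IF; apply: big_ind. Qed.

Lemma prime_exp (D : comNzRingType) (I : D -> Prop) a n :
  ring_prime I -> I (a ^+ n) -> I a.
Proof.
move=> [_ [n1 IM]]; elim: n => [|n IH]; first by rewrite expr0 => /n1.
by rewrite exprS => /IM[].
Qed.

(** The Nullstellensatz for the [K]-algebra [D]: an element outside a prime ideal is nonzero at some
    [K]-point of its zero set. Requiring [g] to be nonzero at the point lets the statement pass from
    [D] to [D[X]]. *)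
Definition enough_points (K : fieldType) (D : comNzRingType) (iota : K -> D) :=
  forall (P : D -> Prop) (g : D), ring_prime P -> ~ P g ->
  exists q : {rmorphism D -> K},
    [/\ forall c, q (iota c) = c, forall a, P a -> q a = 0 & q g != 0].

Lemma enough_points_field (K : fieldType) : @enough_points K K id.
Proof.
move=> P g [[P0 [PD PM]] [P1 _]] Pg; exists (GRing.RMorphism.clone _ _ idfun _).
split=> // [a Pa|]; last by apply/eqP => /= g0; apply: Pg; rewrite g0.
have [//|a0] := eqVneq (idfun a : K) 0; case: P1.
by rewrite -(mulVf a0); apply: PM.
Qed.

(** * Adjoining one variable *)

Section Step.
Variables (K : closedFieldType) (D : idomainType) (iota : K -> D).
Hypothesis ptsD : enough_points iota.
Hypothesis K_infinite : forall p : {poly K}, p != 0 -> exists x, ~~ root p x.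

Lemma coef_ideal (J : {poly D} -> Prop) (h : {poly D}) :
  ring_ideal J -> (forall i, J (h`_i)%:P) -> J h.
Proof.
move=> JI ch; rewrite -[h]coefK poly_def; apply: ideal_sum => // i _.
by rewrite -mul_polyC; apply: ideal_mulr.
Qed.

(** A leading term with coefficient in [P] can be cut off without leaving [J]. So an element of
    least size among those of [J] with a coefficient outside [P] has its leading coefficient outside
    [P]. *)
Lemma minimal_noncoef (P J : {poly D} -> Prop) g :
  ring_ideal P -> ring_ideal J -> (forall a, P a%:P -> J a%:P) ->
  J g -> ~ (forall i, P (g`_i)%:P) ->
  exists e, [/\ J e, ~ P (lead_coef e)%:P &
    forall h, J h -> (size h < size e)%N -> forall i, P (h`_i)%:P].
Proof.
move=> PI JI PJ; elim: (size g) {-2}g (leqnn (size g)) => {g} [|n IH] g sg Jg ng.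
  by case: ng => i; rewrite nth_default ?(leq_trans sg) //; apply: PI.1.
have [Pl|nPl] := pselect (P (lead_coef g)%:P).
  set g' := g - (lead_coef g)%:P * 'X^((size g).-1).
  have g0 : g != 0.
    apply/eqP => g0; apply: ng => i; rewrite g0 coef0; exact: PI.1.
  apply: (IH g').
  - rewrite -ltnS (leq_trans _ sg) //; have := g0.
    rewrite -size_poly_gt0 => /prednK E; rewrite -[X in (_ < X)%N]E ltnS; apply/leq_sizeP => j sj.
    rewrite coefB coefCM coefXn; move: sj; rewrite leq_eqVlt.
    case/predU1P => [<-|sj]; first by rewrite eqxx mulr1 subrr.
    by rewrite gtn_eqF // mulr0 subr0 nth_default // -[size g]prednK ?size_poly_gt0.
  - by apply: ideal_sub => //; apply: ideal_mulr => //; apply: PJ.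
  - move=> H; apply: ng => i; have := H i; rewrite coefB coefCM coefXn polyCB polyCM => Hi.
    rewrite -[(g`_i)%:P](subrK ((lead_coef g)%:P * (i == (size g).-1)%:R%:P)).
    by apply: PI.2.1 => //; apply: ideal_mulr.
have [small|/existsNP[h /not_implyP[Jh /not_implyP[sh nh]]]] :=
    pselect (forall h, J h -> (size h < size g)%N -> forall i, P (h`_i)%:P).
  by exists g.
by apply: (IH h) => //; rewrite -ltnS (leq_trans sh).
Qed.

(** Let [p] be the contraction of [P] to [D]. If [P] consists of polynomials with coefficients in
    [p], a point of [p] where some coefficient of [g] survives is extended by a non-root of the
    image of [g]. Otherwise an [f] of least degree generates [P] modulo [p], up to powers of its
    leading coefficient, and [P + (g)] contains a constant [al] outside [p]. A point of [p] where
    [al] and the leading coefficient of [f] are nonzero is then extended by a root of the image of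
    [f]. *)
Lemma enough_points_poly : enough_points (fun c => (iota c)%:P).
Proof.
move=> P g PP Pg; have [PI [P1 PM]] := PP.
pose p a := P a%:P.
have pP : ring_prime p.
  split; first split; first by rewrite /p polyC0; apply: PI.1.
    split=> a b; rewrite /p ?polyCD ?polyCM; first exact: PI.2.1.
    exact: PI.2.2.
  by split=> // a b; rewrite /p polyCM => /PM.
have Pcoef (h : {poly D}) : (forall i, p h`_i) -> P h by apply: coef_ideal.
have evalE (q : {rmorphism D -> K}) x h : eval_ext q x h = (map_poly q h).[x] by [].
have ncg : ~ (forall i, p g`_i) by move/Pcoef.
have [allP|/existsNP[f0 /not_implyP[Pf0 nf0]]] :=
    pselect (forall h : {poly D}, P h -> forall i, p h`_i).
  have /existsNP[i ngi] := ncg.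
  have [q [qK qp qg]] := ptsD pP ngi.
  have [|x xr] := K_infinite (p := map_poly q g).
    by apply: contraNneq qg => E; rewrite -coef_map E coef0.
  exists (eval_ext q x); split=> [c|a /allP pa|].
  - by rewrite evalE map_polyC hornerC /= qK.
  - rewrite evalE (_ : map_poly q a = 0) ?horner0 //.
    by apply/polyP => i0; rewrite coef_map coef0; exact/qp/pa.
  - by rewrite evalE.
have [f [Pf nlf fmin]] := minimal_noncoef PI PI (fun _ H => H) Pf0 nf0.
pose J (h : {poly D}) := exists a b : {poly D}, P a /\ h = a + b * g.
have PJ (h : {poly D}) : P h -> J h by move=> Ph; exists h, 0; rewrite mul0r addr0.
have JI : ring_ideal J.
  split; first exact/PJ/PI.1.
  split=> a b; last by move=> [u [v [Pu ->]]]; exists (a * u), (a * v);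
    rewrite mulrDr mulrA; split=> //; apply: PI.2.2.
  move=> [u [v [Pu ->]]] [u' [v' [Pu' ->]]]; exists (u + u'), (v + v').
  by rewrite mulrDl addrACA; split=> //; apply: PI.2.1.
have Jg : J g by exists 0, 1; rewrite mul1r add0r; split=> //; apply: PI.1.
have [e [Je nle emin]] := minimal_noncoef PI JI (fun _ H => PJ _ H) Jg ncg.
have pexp a b n : ~ p a -> p (a ^+ n * b) -> p b.
  by move=> na /(pP.2.2)[/(prime_exp pP)|].
have f0N : f != 0 by apply/eqP => f0E; apply: nlf; rewrite f0E lead_coef0; exact: pP.1.1.
have e0N : e != 0 by apply/eqP => f0E; apply: nle; rewrite f0E lead_coef0; exact: pP.1.1.
have divp_in (h d : {poly D}) : d != 0 -> exists (k : nat) (Q r : {poly D}),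
    (lead_coef d ^+ k) *: h = Q * d + r /\
    (size r < size d)%N.
  move=> d0; exists (scalp h d), (h %/ d), (h %% d).
  by rewrite -Pdiv.Idomain.divp_eq ltn_modp.
have cancelP (a : D) n (h : {poly D}) : ~ p a -> P ((a ^+ n) *: h) -> P h.
  by rewrite -mul_polyC => na /PM[|//]; rewrite polyC_exp => /(prime_exp PP)/na.
(* Pseudo-division of [f] by [e] leaves a remainder in [P], so [Q * e] is in [P]. If [Q] is in [P]
   and [e] is not constant, [Q] is shorter than [f], against the choice of [f]. If [e] is in [P],
   then [f] is no longer than [e], and pseudo-division of [g] by [f] puts [g] in [P]. *)
have e_const : size e = 1%N.
  have [k [Q [r [E sr]]]] := divp_in f _ e0N.
  have Jr : J r.
    apply: (ideal_addr JI (a := Q * e)); first exact: JI.2.2.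
    by rewrite -E; apply/PJ; rewrite -mul_polyC; apply: PI.2.2.
  have Pr := Pcoef _ (emin _ Jr sr).
  have PQe : P (Q * e).
    apply: (ideal_addr PI Pr); rewrite addrC -E -mul_polyC; exact: PI.2.2.
  case: (PM _ _ PQe) => [PQ|Pe].
    apply/eqP; rewrite eqn_leq [(0 < _)%N]size_poly_gt0 e0N andbT leqNgt; apply/negP => se.
    have sQ : (size Q < size f)%N.
      have [->|Q0] := eqVneq Q 0; first by rewrite size_poly0 size_poly_gt0.
      have lf0 : lead_coef e ^+ k != 0 by rewrite expf_neq0 // lead_coef_eq0.
      rewrite -(size_scale f lf0) E size_polyDl; last first.
        rewrite size_mul //; apply: leq_trans sr _.
        by move: Q0; rewrite -size_poly_gt0; case: (size Q) => // n _; rewrite addSn leq_addl.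
      rewrite size_mul //; case: (size e) se => [|[|m]] // _.
      by rewrite !addnS /= ltnS leq_addr.
    have cQ := fmin _ PQ sQ.
    apply: nlf; apply: (pexp (lead_coef e) _ k) => //.
    rewrite /lead_coef -coefZ -/(lead_coef e) E coefD; apply: pP.1.2.1; last exact: emin.
    by rewrite coefM; apply: (@ideal_sum _ p _ _ _ _ pP.1) => i _; apply: (ideal_mulr _ pP.1).
  have sfe : (size f <= size e)%N.
    by rewrite leqNgt; apply/negP => /(fmin _ Pe)/(_ (size e).-1)/nle.
  have [k' [Q' [r' [E' sr']]]] := divp_in g _ f0N.
  have Jr' : J r'.
    apply: (ideal_addr JI (a := Q' * f)); first exact/PJ/PI.2.2.
    by rewrite -E' -mul_polyC; apply: JI.2.2.
  have Pr' := Pcoef _ (emin _ Jr' (leq_trans sr' sfe)).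
  case: Pg; apply: (cancelP _ k' _ nlf); rewrite E'.
  by apply: PI.2.1 => //; apply: PI.2.2.
have [al al0 eE] := size1_polyC e_const.
have nal : ~ p al by rewrite eE lead_coefC in nle.
have nboth : ~ p (lead_coef f * al) by move=> /(pP.2.2)[].
have [q [qK qp qg]] := ptsD pP nboth.
move: qg; rewrite rmorphM mulf_eq0 negb_or => /andP[ql qal].
have sf : size (map_poly q f) = size f by rewrite size_map_poly_id0.
have f1 : size (map_poly q f) != 1%N.
  rewrite sf; apply/eqP => /size1_polyC[c _ fE].
  by apply: nlf; rewrite fE lead_coefC -fE.
(* The leading coefficient of [f] survives under [q], so the image of [f] is nonconstant and has a
   root. *)
have /closed_rootP[x xr] := f1.
pose r := eval_ext q x; have rE h : r h = (map_poly q h).[x] by [].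
have rf : r f = 0 by rewrite rE; apply/eqP.
have rP h : P h -> r h = 0.
  move=> Ph; have [k [Q [h' [E sh']]]] := divp_in h _ f0N.
  have Ph' : P h'.
    apply: (ideal_addr PI (a := Q * f)); first exact: PI.2.2.
    by rewrite -E -mul_polyC; apply: PI.2.2.
  have rh' : r h' = 0.
    rewrite rE (_ : map_poly q h' = 0) ?horner0 //.
    by apply/polyP => i0; rewrite coef_map coef0; apply/qp/fmin.
  have := congr1 r E; rewrite rmorphD rmorphM rf mulr0 rh' addr0 -mul_polyC rmorphM.
  rewrite rE map_polyC hornerC /= rmorphXn => /eqP.
  by rewrite mulf_eq0 expf_eq0 (negPf ql) andbF /= => /eqP.
exists r; split=> // [c|]; first by rewrite rE map_polyC hornerC /= qK.
move: Je => [a [b [Pa eE']]]; have := congr1 r eE'.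
rewrite rmorphD rmorphM (rP a) // add0r eE rE map_polyC hornerC /= => qE.
by apply: contraNneq qal => rg; rewrite qE rg mulr0.
Qed.

End Step.
End Nullstellensatz.

(** * Polynomials in three variables as iterated polynomials *)

Section Transport.
Variables (A B : comNzRingType) (phi : {rmorphism A -> B}) (psi : {rmorphism B -> A}).
Hypotheses (phiK : cancel phi psi) (psiK : cancel psi phi).

Lemma rdvd_morph a b : rdvd a b <-> rdvd (phi a) (phi b).
Proof.
split=> [[q ->]|[q]]; first by exists (phi q); rewrite rmorphM.
by move/(congr1 psi); rewrite rmorphM !phiK => ->; exists (psi q).
Qed.

Lemma runit_morph a : runit a <-> runit (phi a).
Proof. by rewrite -!rdvd1 rdvd_morph rmorph1. Qed.

Lemma rirreducible_morph a : rirreducible a -> rirreducible (phi a).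
Proof.
move=> [a0 [nu aM]]; split; first by rewrite -(rmorph0 phi) => /(can_inj phiK).
split=> [/runit_morph//|x y].
by rewrite -[x]psiK -[y]psiK -rmorphM -!runit_morph => /(can_inj phiK); exact: aM.
Qed.

Lemma rprime_morph a : rprime a -> rprime (phi a).
Proof.
move=> [a0 [nu aM]]; split; first by rewrite -(rmorph0 phi) => /(can_inj phiK).
split=> [/runit_morph//|x y].
by rewrite -[x]psiK -[y]psiK -rmorphM -!rdvd_morph; exact: aM.
Qed.
End Transport.

Lemma factorial_iso (A B : comNzRingType) (phi : {rmorphism A -> B})
    (psi : {rmorphism B -> A}) : cancel phi psi -> cancel psi phi ->
  factorial_ring B -> factorial_ring A.
Proof.
move=> phiK psiK [[l [lM l0]] irrP]; split.
  have phi0 a : (phi a != 0) = (a != 0).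
    by rewrite -(inj_eq (can_inj phiK)) rmorph0.
  exists (l \o phi); split=> [a b a0 b0|a a0] /=; last first.
    by rewrite (runit_morph phiK); apply: l0; rewrite phi0.
  by rewrite rmorphM lM ?phi0.
move=> u /(rirreducible_morph phiK psiK)/irrP/(rprime_morph psiK phiK).
by rewrite phiK.
Qed.

Lemma enough_points_iso (K : fieldType) (A B : comNzRingType)
    (phi : {rmorphism A -> B}) (psi : {rmorphism B -> A}) (iota : K -> B) :
  cancel phi psi -> cancel psi phi ->
  enough_points iota -> enough_points (psi \o iota).
Proof.
move=> phiK psiK pts P g [PI [P1 PM]] Pg.
case: (pts (P \o psi) (phi g)) => [||q [qK qP qg]].
- split; last by split=> [|a b] /=; rewrite ?rmorph1 // rmorphM; exact: PM.
  split; first by rewrite /= rmorph0; exact: PI.1.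
  by split=> a b /=; rewrite ?rmorphD ?rmorphM; [exact: PI.2.1|exact: PI.2.2].
- by rewrite /= phiK.
exists (GRing.RMorphism.clone _ _ (q \o phi) _).
by split=> [c|a Pa|] //=; rewrite ?psiK //; apply: qP; rewrite /= phiK.
Qed.

Lemma poly_rmorph_eq (D S : comNzRingType) (f g : {rmorphism {poly D} -> S}) :
  (forall c, f c%:P = g c%:P) -> f 'X = g 'X -> f =1 g.
Proof.
move=> fgC fgX; elim/poly_ind => [|p c IH]; first by rewrite !rmorph0.
by rewrite !rmorphD !rmorphM IH fgC fgX.
Qed.

Lemma mpoly_ring_ind (n : nat) (R : comNzRingType) (P : {mpoly R[n]} -> Prop) :
  (forall c, P c%:MP) -> (forall i, P 'X_i) ->
  (forall p q, P p -> P q -> P (p + q)) ->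
  (forall p q, P p -> P q -> P (p * q)) -> forall p, P p.
Proof.
move=> PC PX PD PM p; rewrite [p]mpolyE.
apply: big_ind => [|//|m _]; first by rewrite -mpolyC0.
rewrite -mul_mpolyC mpolyXE_id; apply: (PM) => //.
apply: big_ind => [|p1 p2|i _]; [by rewrite -mpolyC1 | exact: PM |].
by elim: (m i) => [|k IH]; rewrite ?expr0 -?mpolyC1 // exprS; apply: (PM).
Qed.

Lemma mpoly_rmorph_eq (n : nat) (R S : comNzRingType)
    (f g : {rmorphism {mpoly R[n]} -> S}) :
  (forall c, f c%:MP = g c%:MP) -> (forall i, f 'X_i = g 'X_i) -> f =1 g.
Proof.
move=> fgC fgX; apply: mpoly_ring_ind => // p q; by rewrite ?rmorphD ?rmorphM => -> ->.
Qed.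

Section Nested.
Variables (K : fieldType) (a b c : 'I_3).
Hypothesis abc : uniq [:: a; b; c].
Local Notation A := {mpoly K[3]}.
Local Notation B := {poly {poly {poly K}}}.

(** The order [a], [b], [c] is left free so that any variable can be the outermost one, ['X_c],
    which is the one eliminated below. *)
Definition of_nested : {rmorphism B -> A} :=
  eval_ext (eval_ext (eval_ext (@mpolyC 3 K) 'X_a) 'X_b) 'X_c.

Definition const3 : {rmorphism K -> B} :=
  GRing.RMorphism.clone K B
    (@polyC {poly {poly K}} \o (@polyC {poly K} \o @polyC K)) _.

Definition var3 (i : 'I_3) : B :=
  if i == a then 'X%:P%:P else if i == b then 'X%:P else 'X.

Definition to_nested : {rmorphism A -> B} :=
  GRing.RMorphism.clone A B (mmap const3 var3) _.

Lemma to_nestedC k : to_nested k%:MP = k%:P%:P%:P.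
Proof. by rewrite /= mmapC. Qed.

Lemma to_nestedX i : to_nested 'X_i = var3 i.
Proof. by rewrite /= mmapX mmap1U. Qed.

Lemma of_nestedC k : of_nested k%:P%:P%:P = k%:MP.
Proof. by rewrite /of_nested !eval_extC. Qed.

Lemma ord3_cover i : [|| i == a, i == b | i == c].
Proof.
move: abc; rewrite /= !inE -!val_eqE /=.
by case: a => [[|[|[|//]]] ?]; case: b => [[|[|[|//]]] ?];
   case: c => [[|[|[|//]]] ?]; case: i => [[|[|[|//]]] ?].
Qed.

Lemma neq3 : [/\ a != b, a != c & b != c].
Proof. by move: abc; rewrite /= !inE negb_or => /and3P[/andP[]]. Qed.

Lemma var3E : [/\ var3 a = 'X%:P%:P, var3 b = 'X%:P & var3 c = 'X].
Proof.
have [ab ac bc] := neq3; rewrite /var3.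
by rewrite !eqxx ![_ == a]eq_sym [c == b]eq_sym (negPf ab) (negPf ac) (negPf bc).
Qed.

Lemma to_nestedK : cancel to_nested of_nested.
Proof.
have HC k : of_nested (to_nested k%:MP) = k%:MP by rewrite to_nestedC of_nestedC.
have HX i : of_nested (to_nested 'X_i) = 'X_i.
  have [va vb vc] := var3E.
  by rewrite to_nestedX /of_nested; case/or3P: (ord3_cover i) => /eqP->;
    rewrite (va, vb, vc) ?eval_extC ?eval_extC eval_extX.
exact: (mpoly_rmorph_eq (f := GRing.RMorphism.clone A A (of_nested \o to_nested) _)
  (g := GRing.RMorphism.clone A A idfun _) HC HX).
Qed.

Lemma of_nestedK : cancel of_nested to_nested.
Proof.
have [va vb vc] := var3E.
have HX : to_nested (of_nested 'X) = 'X by rewrite /of_nested eval_extX to_nestedX.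
have HY : to_nested (of_nested 'X%:P) = 'X%:P.
  by rewrite /of_nested eval_extC eval_extX to_nestedX.
have HZ : to_nested (of_nested 'X%:P%:P) = 'X%:P%:P.
  by rewrite /of_nested !eval_extC eval_extX to_nestedX.
have HK k : to_nested (of_nested k%:P%:P%:P) = k%:P%:P%:P.
  by rewrite of_nestedC to_nestedC.
pose h : {rmorphism B -> B} := GRing.RMorphism.clone B B (to_nested \o of_nested) _.
apply: (poly_rmorph_eq (f := h) (g := GRing.RMorphism.clone B B idfun _) _ HX).
pose C1 := @polyC {poly {poly K}}.
apply: (poly_rmorph_eq (f := GRing.RMorphism.clone _ B (h \o C1) _)
  (g := GRing.RMorphism.clone _ B C1 _) _ HY).
pose C2 : {rmorphism {poly K} -> B} := GRing.RMorphism.clone _ B (C1 \o @polyC {poly K}) _.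
exact: (poly_rmorph_eq (f := GRing.RMorphism.clone _ B (h \o C2) _) (g := C2) HK HZ).
Qed.

Lemma of_nested_deriv r : (of_nested r%:P)^`M(c) = 0.
Proof.
have [ab ac bc] := neq3; have dX i : i != c -> ('X_i : A)^`M(c) = 0.
  by move=> ic; rewrite mderivX mnm1E (negPf ic) scale0r.
rewrite /of_nested eval_extC; elim/poly_ind: r => [|r p IH].
  by rewrite rmorph0 mderiv0.
rewrite rmorphD rmorphM eval_extX eval_extC mderivD mderivM IH dX // mul0r mulr0 !add0r.
elim/poly_ind: p => [|p k IHp]; first by rewrite rmorph0 mderiv0.
rewrite rmorphD rmorphM eval_extX eval_extC mderivD mderivM IHp dX //.
by rewrite mul0r mulr0 !add0r mderivC.
Qed.

Lemma factorial_nested : factorial_ring B.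
Proof. by do 3!apply: factorial_poly; exact: factorial_field. Qed.

Lemma mpoly3_factorial : factorial_ring A.
Proof. exact: factorial_iso to_nestedK of_nestedK factorial_nested. Qed.

(** [u] and [v] are viewed as polynomials in ['X_c]. The nonzero constant in the ideal they generate
    is a polynomial in the other two variables, which is recorded as a vanishing derivative. *)
Lemma mpoly3_elimination (u v : A) : rprime u -> ~ rdvd u v ->
  exists F : A, [/\ F != 0, F^`M(c) = 0 & exists p q, F = p * u + q * v].
Proof.
move=> /(rprime_morph to_nestedK of_nestedK) pu; rewrite (rdvd_morph to_nestedK).
case/(rprime_elimination pu) => r r0 [p [q E]].
exists (of_nested r%:P); split; last 1 first.
- exists (of_nested p), (of_nested q).
  by rewrite E rmorphD !rmorphM !to_nestedK.
- apply: contra_neq r0; rewrite -(rmorph0 of_nested) => /(can_inj of_nestedK)/eqP.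
  by rewrite polyC_eq0 => /eqP.
- exact: of_nested_deriv.
Qed.

End Nested.

(** * The core of a prime ideal under a sequence of derivations *)

Section DerivationCore.
Variable D : comNzRingType.
Implicit Types (Q J : D -> Prop) (delta : D -> D).

Definition derivation delta :=
  (forall a b, delta (a + b) = delta a + delta b) /\
  (forall a b, delta (a * b) = delta a * b + a * delta b).

Lemma derivation0 delta : derivation delta -> delta 0 = 0.
Proof. by move=> [dD _]; apply: (addrI (delta 0)); rewrite -dD !addr0. Qed.

Lemma derivation_sum delta n (F : 'I_n -> D) : derivation delta ->
  delta (\sum_(i < n) F i) = \sum_(i < n) delta (F i).
Proof. by move=> dd; apply: (big_morph delta dd.1 (derivation0 dd)). Qed.

Lemma derivationMn delta a n : derivation delta -> delta (a *+ n) = delta a *+ n.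
Proof.
move=> dd; elim: n => [|n IH]; first by rewrite !mulr0n derivation0.
by rewrite !mulrS dd.1 IH.
Qed.

(** Leibniz's formula for iterated derivations, by induction and Pascal's rule. *)
Lemma iter_derivationM delta a b n : derivation delta ->
  iter n delta (a * b) =
  \sum_(k < n.+1) (iter k delta a * iter (n - k) delta b) *+ 'C(n, k).
Proof.
move=> dd; elim: n => [|n IH]; first by rewrite big_ord1.
rewrite iterS IH derivation_sum // [RHS]big_ord_recl bin0 subn0 mulr1n.
under eq_bigr => k _ do rewrite derivationMn // dd.2 mulrnDl.
rewrite big_split /= addrC.
under [in RHS]eq_bigr => k _ do rewrite /bump /= add1n subSS binS mulrnDr.
rewrite big_split /= addrA; congr (_ + _).
rewrite big_ord_recl bin0 subn0 mulr1n; congr (_ + _).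
rewrite [RHS]big_ord_recr /= bin_small // mulr0n addr0.
by apply: eq_bigr => k _; rewrite /bump /= add1n -[delta (iter _ delta b)]iterS subnSK.
Qed.

Lemma iter_derivationD delta a b n : derivation delta ->
  iter n delta (a + b) = iter n delta a + iter n delta b.
Proof. by move=> dd; elim: n => //= n ->; rewrite dd.1. Qed.

(** The largest [delta]-stable subset of [Q]. *)
Definition stable_part delta Q a := forall k, Q (iter k delta a).

Lemma least_index (P : nat -> Prop) : ~ (forall n, P n) ->
  exists n, ~ P n /\ forall m, (m < n)%N -> P m.
Proof.
move=> /existsNP[n0 Pn0]; have ex : exists n, `[< ~ P n >] by exists n0; apply/asboolP.
case: (ex_minnP ex) => n /asboolP Pn nmin; exists n; split=> // m.
by rewrite ltnNge => /negP mn; apply: contrapT => /asboolP/nmin.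
Qed.

(** The form in which characteristic zero enters: binomial coefficients can be cancelled modulo
    [Q]. *)
Definition torsion_free_mod Q := forall a n, Q (a *+ n.+1) -> Q a.

(* If m and n are the least exponents with [delta^m a] and [delta^n b] outside
   [Q], the only term of the Leibniz formula for [delta^(m+n) (a b)] outside [Q]
   is a nonzero multiple of [delta^m a * delta^n b]. *)
Lemma stable_part_prime delta Q : derivation delta -> ring_prime Q ->
  torsion_free_mod Q -> ring_prime (stable_part delta Q).
Proof.
move=> dd [QI [Q1 QM]] Qtf; have Q0 := QI.1.
have it0 k : iter k delta 0 = 0 by elim: k => //= k ->; rewrite derivation0.
split; first split; first by move=> k; rewrite it0.
  split=> a b => [Sa Sb k|Sb k].
    by rewrite iter_derivationD //; apply: QI.2.1.
  rewrite iter_derivationM //; apply: ideal_sum => // i _.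
  by rewrite -mulr_natr; apply: ideal_mulr => //; apply: QI.2.2.
split=> [/(_ 0%N)//|a b Sab]; apply: contrapT => /not_orP[].
move=> /least_index[m [am amin]] /least_index[n [bn bmin]].
have /QM[]// : Q (iter m delta a * iter n delta b).
have mn : (m < (m + n).+1)%N by rewrite ltnS leq_addr.
have := Sab (m + n)%N; rewrite iter_derivationM // (bigD1 (Ordinal mn)) //= addKn.
rewrite addrC => H.
have : Q (iter m delta a * iter n delta b *+ 'C(m + n, m)).
  apply: (ideal_addr QI _ H); apply: ideal_sum => // i im.
  rewrite -mulr_natr; apply: ideal_mulr => //.
  have [lt|gt|E] := ltngtP (i : nat) m; last by move/eqP: im; case; apply: val_inj.
    by apply: ideal_mulr => //; apply: amin.
  by apply: QI.2.2; apply: bmin; rewrite ltn_subLR ?ltn_add2r // -ltnS.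
have : (0 < 'C(m + n, m))%N by rewrite bin_gt0 leq_addr.
by case: 'C(_, _) => // j _; exact: Qtf.
Qed.

Fixpoint core_chain (delta : nat -> D -> D) Q n :=
  if n is n'.+1 then stable_part (delta n') (core_chain delta Q n') else Q.

(** A stable part for one derivation need not be stable under the earlier ones. The intersection is
    stable under every derivation that recurs infinitely often in the sequence. *)
Definition core_limit (delta : nat -> D -> D) Q a := forall n, core_chain delta Q n a.

Variable delta : nat -> D -> D.
Hypothesis deltaP : forall n, derivation (delta n).

Lemma core_chain_torsion_free Q n :
  torsion_free_mod Q -> torsion_free_mod (core_chain delta Q n).
Proof.
move=> Qtf; elim: n => //= n IH a k H j; apply: (IH _ k).
have := H j; suff -> : iter j (delta n) (a *+ k.+1) = iter j (delta n) a *+ k.+1 by [].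
by elim: j {H} => //= j ->; rewrite derivationMn.
Qed.

Lemma core_chain_prime Q n : ring_prime Q -> torsion_free_mod Q ->
  ring_prime (core_chain delta Q n).
Proof.
move=> QP Qtf; elim: n => //= n IH.
by apply: stable_part_prime => //; exact: core_chain_torsion_free.
Qed.

Lemma core_chain_decr Q m n a : (m <= n)%N ->
  core_chain delta Q n a -> core_chain delta Q m a.
Proof.
move=> /subnK <-; elim: (n - m)%N => //= k IH H; apply: IH; exact: (H 0%N).
Qed.

(** The chain is decreasing, and the intersection of a decreasing chain of primes is prime. *)
Lemma core_limit_prime Q : ring_prime Q -> torsion_free_mod Q ->
  ring_prime (core_limit delta Q).
Proof.
move=> QP Qtf; have cP n := core_chain_prime n QP Qtf.
split; first split; first by move=> n; exact: (cP n).1.1.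
  by split=> a b => [Ha Hb n|Hb n]; [apply: (cP n).1.2.1|apply: (cP n).1.2.2].
split=> [/(_ 0%N)|a b ab]; first exact: (cP 0%N).2.1.
apply: contrapT => /not_orP[/existsNP[m am] /existsNP[n bn]].
case: ((cP (maxn m n)).2.2 _ _ (ab _)) => /core_chain_decr H.
  by apply: am; apply: H; rewrite leq_maxl.
by apply: bn; apply: H; rewrite leq_maxr.
Qed.

(** Given a level [m], the derivation recurs at some [n >= m], and level [n.+1] is stable under
    it. *)
Lemma core_limit_stable Q i a : (forall m, exists2 n, (m <= n)%N & delta n = delta i) ->
  core_limit delta Q a -> core_limit delta Q (delta i a).
Proof.
move=> inf Ha m; have [n mn <-] := inf m.
apply: (@core_chain_decr Q m n.+1); first exact: leqW.
by move=> k; rewrite -iterSr; exact: (Ha n.+1).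
Qed.

Lemma core_limit_max Q J : (forall a, J a -> Q a) ->
  (forall n a, J a -> J (delta n a)) -> forall a, J a -> core_limit delta Q a.
Proof.
move=> JQ Jd a Ja n; elim: n a Ja => [|n IH] a Ja /=; first exact: JQ.
by move=> k; apply: IH; elim: k => //= k; exact: Jd.
Qed.

End DerivationCore.

(** * Partial derivatives, degree and divisibility *)

Lemma msize_mderiv_lt (n : nat) (R : idomainType) (F : {mpoly R[n]}) i :
  F^`M(i) != 0 -> (msize F^`M(i) < msize F)%N.
Proof.
move=> F0; rewrite -mlead_deg //; have := mlead_supp F0.
set m := mlead _; rewrite mcoeff_msupp mcoeff_mderiv => H.
have : (m + U_(i))%MM \in msupp F.
  by rewrite mcoeff_msupp; apply: contraNneq H => ->; rewrite mul0rn.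
by move/msize_mdeg_lt; rewrite mdegD mdeg1 addn1.
Qed.

Lemma mderiv_eq0_const (n : nat) (R : numFieldType) (F : {mpoly R[n]}) :
  (forall i, F^`M(i) = 0) -> F = (F@_0)%:MP.
Proof.
move=> F0; apply/mpolyP => m; rewrite mcoeffC.
have [->|m0] := eqVneq m 0%MM; first by rewrite mulr1.
rewrite mulr0; have [i mi] : exists i, m i != 0%N.
  apply: contrapT => H; move/eqP: m0; apply; apply/mnmP => i.
  by rewrite mnm0E; apply/eqP; apply: contrapT => /negP mi; apply: H; exists i.
have le : (U_(i) <= m)%MM.
  by apply/mnm_lepP => j; rewrite mnm1E; case: eqP => // <-; rewrite lt0n.
have := congr1 (mcoeff (m - U_(i))%MM) (F0 i).
rewrite mcoeff_mderiv submK // mcoeff0 => /eqP.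
by rewrite mulrn_eq0 => /eqP.
Qed.

(** A derivative has smaller degree, so it is divisible by [u] only if it vanishes. If all of them
    vanish, [u] is a nonzero constant. *)
Lemma not_rdvd_mderiv (R : numFieldType) (n : nat) (u : {mpoly R[n]}) :
  u <> 0 -> ~ runit u -> exists i, ~ rdvd u u^`M(i).
Proof.
move=> /eqP u0 nu; apply: contrapT => H; apply: nu.
have uc : u = (u@_0)%:MP.
  apply: mderiv_eq0_const => i; apply: contrapT => /eqP di.
  apply: H; exists i => -[q qE]; have := msize_mderiv_lt di.
  have q0 : q != 0 by apply: contraNneq di => q0; rewrite qE q0 mul0r.
  rewrite qE msizeM // ltnNge; case/negP.
  by move: q0; rewrite -msize_poly_eq0; case: (msize q) => // k _; rewrite addSn leq_addl.
exists (u@_0)^-1%:MP; rewrite {1}uc -mpolyCM mulfV ?mpolyC1 //.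
by apply: contraNneq u0 => E; rewrite uc E mpolyC0.
Qed.

(** * The Poisson bracket *)

Section PoissonBracket.
Variable C : comNzRingType.
Local Notation A := {mpoly C[3]}.
Implicit Types (s t a b f g : A).

Lemma partials_var : [/\ [/\ dx (Px C) = 1, dy (Px C) = 0 & dz (Px C) = 0],
  [/\ dx (Py C) = 0, dy (Py C) = 1 & dz (Py C) = 0] &
  [/\ dx (Pz C) = 0, dy (Pz C) = 0 & dz (Pz C) = 1]].
Proof.
have diag (i : 'I_3) : ('X_i : A)^`M(i) = 1.
  by rewrite mderivX mnm1E eqxx scale1r -{1}[U_(i)%MM]add0m addmK mpolyX0.
have off (i j : 'I_3) : i != j -> ('X_i : A)^`M(j) = 0.
  by move=> ij; rewrite mderivX mnm1E (negPf ij) scale0r.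
by split; split; rewrite /dx /dy /dz /Px /Py /Pz ?diag ?off.
Qed.

Lemma pbr_var s t :
  [/\ [/\ pbr s t (Px C) (Px C) = 0, pbr s t (Px C) (Py C) = cz s t &
          pbr s t (Px C) (Pz C) = - cy s t],
      [/\ pbr s t (Py C) (Px C) = - cz s t, pbr s t (Py C) (Py C) = 0 &
          pbr s t (Py C) (Pz C) = cx s t] &
      [/\ pbr s t (Pz C) (Px C) = cy s t, pbr s t (Pz C) (Py C) = - cx s t &
          pbr s t (Pz C) (Pz C) = 0]].
Proof.
have [[xx yx zx] [xy yy zy] [xz yz zz]] := partials_var.
by split; split; rewrite /pbr ?xx ?yx ?zx ?xy ?yy ?zy ?xz ?yz ?zz; ring.
Qed.

Lemma pbrDr s t a b c : pbr s t a (b + c) = pbr s t a b + pbr s t a c.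
Proof. by rewrite /pbr /dx /dy /dz !mderivD; ring. Qed.

Lemma pbrMr s t a b c : pbr s t a (b * c) = pbr s t a b * c + b * pbr s t a c.
Proof. by rewrite /pbr /dx /dy /dz !mderivM; ring. Qed.

Lemma pbrC s t a b : pbr s t a b = - pbr s t b a.
Proof. by rewrite /pbr; ring. Qed.

Lemma pbr_constr s t a k : pbr s t a k%:MP = 0.
Proof. by rewrite /pbr /dx /dy /dz !mderivC; ring. Qed.

Lemma pbrBr s t a b c : pbr s t a (b - c) = pbr s t a b - pbr s t a c.
Proof. by rewrite /pbr /dx /dy /dz !mderivB; ring. Qed.

Lemma pbrMl s t a b c : pbr s t (a * b) c = pbr s t a c * b + a * pbr s t b c.
Proof. by rewrite pbrC pbrMr (pbrC s t c a) (pbrC s t c b); ring. Qed.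

Lemma pbrBl s t a b c : pbr s t (a - b) c = pbr s t a c - pbr s t b c.
Proof. by rewrite pbrC pbrBr (pbrC s t c a) (pbrC s t c b); ring. Qed.

Lemma pbr_constl s t a k : pbr s t k%:MP a = 0.
Proof. by rewrite pbrC pbr_constr oppr0. Qed.

Lemma pbr_derivation s t a : derivation (pbr s t a).
Proof. by split=> b c; rewrite ?pbrDr ?pbrMr. Qed.

Lemma pbr_expand s t a b : pbr s t a b =
  dx a * pbr s t (Px C) b + dy a * pbr s t (Py C) b + dz a * pbr s t (Pz C) b.
Proof.
have [[xx yx zx] [xy yy zy] [xz yz zz]] := partials_var.
by rewrite /pbr xx yx zx xy yy zy xz yz zz; ring.
Qed.

Lemma poisson_ideal_gen s t I : ideal I ->
  (forall b, I b -> I (pbr s t (Px C) b)) -> (forall b, I b -> I (pbr s t (Py C) b)) ->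
  (forall b, I b -> I (pbr s t (Pz C) b)) -> poisson_ideal s t I.
Proof.
move=> II Ix Iy Iz; split=> // a b Ib; rewrite pbr_expand.
apply: II.2.1; [apply: II.2.1|]; apply: II.2.2; [exact: Ix|exact: Iy|exact: Iz].
Qed.

Lemma pbr_in s t I : ideal I -> I (cx s t) -> I (cy s t) -> I (cz s t) ->
  forall a b, I (pbr s t a b).
Proof.
move=> II Ix Iy Iz a b; rewrite /pbr.
have HM d c : I c -> I (d * c) by apply: II.2.2.
by do !(first [apply: (ideal_sub II) | apply: II.2.1]); apply: HM.
Qed.

Lemma c_of_pbr s t I : (forall a b, I (pbr s t a b)) ->
  [/\ I (cx s t), I (cy s t) & I (cz s t)].
Proof.
have [[_ <- _] [_ _ <-] [<- _ _]] := pbr_var s t.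
by move=> IA; split.
Qed.

Lemma cross_t s t lam mu (f := lam *: s - mu *: t) :
  [/\ cx f t = lam *: cx s t, cy f t = lam *: cy s t & cz f t = lam *: cz s t].
Proof.
rewrite /f /cx /cy /cz /dx /dy /dz !mderivB !mderivZ -!mul_mpolyC.
by split; ring.
Qed.

Lemma cross_s s t lam mu (f := lam *: s - mu *: t) :
  [/\ cx f s = mu *: cx s t, cy f s = mu *: cy s t & cz f s = mu *: cz s t].
Proof.
rewrite /f /cx /cy /cz /dx /dy /dz !mderivB !mderivZ -!mul_mpolyC.
by split; ring.
Qed.

(** The bracket is the determinant of [grad a], [grad f] and [t grad f - f grad t]. The part
    [t grad f] contributes zero, and what remains is [f] times minus the Jacobian determinant of
    [a], [f], [t]. *)
Lemma pbr_self f t a : mdvd f (pbr f t a f).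
Proof.
exists (- (dx a * dy f * dz t - dy a * dx f * dz t
  + dy a * dz f * dx t - dz a * dy f * dx t + dz a * dx f * dy t - dx a * dz f * dy t)).
by rewrite /pbr /cx /cy /cz; ring.
Qed.

End PoissonBracket.

Lemma eqI_eq (C : comNzRingType) (I J : {mpoly C[3]} -> Prop) : eqI I J -> I = J.
Proof. by move=> IJ; apply/funext => a; apply/propext. Qed.

(** * Points, maximal ideals and the Nullstellensatz in three variables *)

Section Field.
Variable K : numClosedFieldType.
Local Notation A := {mpoly K[3]}.
Implicit Types (s t a b f g u : A) (I J P Q M : A -> Prop).

Lemma ideal_scale I k a : ideal I -> k != 0 -> I (k *: a) -> I a.
Proof.
move=> II k0 /(II.2.2 (k^-1)%:MP); rewrite -mul_mpolyC mulrA -mpolyCM.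
by rewrite mulVf // mpolyC1 mul1r.
Qed.

Lemma ideal_scaler I k a : ideal I -> I a -> I (k *: a).
Proof. by move=> II Ia; rewrite -mul_mpolyC; apply: II.2.2. Qed.

Lemma torsion_free_char0 I : ideal I -> torsion_free_mod I.
Proof.
move=> II a n; rewrite -scaler_nat; apply: ideal_scale => //.
by rewrite pnatr_eq0.
Qed.

(** Up to a nonzero scalar, the bracket is the one built from [f] and [t], or from [f] and [s],
    according to which of [lam], [mu] is nonzero. *)
Lemma pencil_poisson s t lam mu a : (lam != 0) || (mu != 0) ->
  mdvd (lam *: s - mu *: t) (pbr s t a (lam *: s - mu *: t)).
Proof.
set f := _ - _ => lm.
have fI : ideal (mdvd f) by split; [exact: rdvdr0|split; [exact: rdvdD|exact: rdvd_mull]].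
have pbrZ (k : K) (s' t' : A) b c : cx s' t' = k *: cx s t -> cy s' t' = k *: cy s t ->
    cz s' t' = k *: cz s t -> pbr s' t' b c = k *: pbr s t b c.
  by rewrite /pbr => -> -> ->; rewrite -!mul_mpolyC; ring.
case/orP: lm => k0; apply: (ideal_scale fI k0).
  have [ex ey ez] := cross_t s t lam mu; rewrite -(pbrZ _ _ _ _ _ ex ey ez).
  exact: pbr_self.
have [ex ey ez] := cross_s s t lam mu; rewrite -(pbrZ _ _ _ _ _ ex ey ez).
exact: pbr_self.
Qed.

Definition vanishing (v : 'I_3 -> K) a := a.@[v] = 0.

(** Modulo the three generators every polynomial is congruent to a constant, which must be its value
    at the point. *)
Lemma pt_idealE al be ga : pt_ideal al be ga = vanishing (pt al be ga).
Proof.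
apply/funext => a; apply/propext; split.
  move=> [q1 [q2 [q3 ->]]]; rewrite /vanishing !rmorphD !rmorphM !rmorphB /=.
  by rewrite !mevalXU !mevalC /pt /= !subrr !mulr0 !addr0.
have II : ideal (pt_ideal al be ga).
  split; first by exists 0, 0, 0; rewrite !mul0r !addr0.
  split=> [b c [p1 [p2 [p3 ->]]] [q1 [q2 [q3 ->]]]|b c [q1 [q2 [q3 ->]]]].
    by exists (p1 + q1), (p2 + q2), (p3 + q3); ring.
  by exists (b * q1), (b * q2), (b * q3); ring.
suff : exists c, pt_ideal al be ga (a - c%:MP).
  move=> [c Hc] va; suff c0 : c = 0 by rewrite c0 mpolyC0 subr0 in Hc.
  move: Hc => [q1 [q2 [q3]]] /(congr1 (meval (pt al be ga))).
  rewrite !(mevalD, mevalM, mevalN, mevalXU, mevalC) va /pt /= !subrr !mulr0 !addr0.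
  by rewrite sub0r => /eqP; rewrite oppr_eq0 => /eqP.
elim/mpoly_ring_ind: a => [k|i|a b [k Ha] [l Hb]|a b [k Ha] [l Hb]].
- by exists k; rewrite subrr; exact: II.1.
- exists (pt al be ga i); case: i => [[|[|[|//]]] lt].
  + by exists 1, 0, 0; rewrite !mul0r mul1r !addr0; congr ('X_ _ - _); apply: val_inj.
  + by exists 0, 1, 0; rewrite !mul0r mul1r add0r addr0; congr ('X_ _ - _); apply: val_inj.
  by exists 0, 0, 1; rewrite !mul0r mul1r !add0r; congr ('X_ _ - _); apply: val_inj.
- exists (k + l); rewrite mpolyCD opprD addrACA; exact: II.2.1.
exists (k * l); rewrite mpolyCM.
rewrite (_ : _ - _ = b * (a - k%:MP) + k%:MP * (b - l%:MP)); last by ring.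
by apply: II.2.1; apply: II.2.2.
Qed.

Lemma vanishing_prime v : prime_ideal (vanishing v).
Proof.
rewrite /vanishing; split; first split; first by rewrite meval0.
  by split=> a b; [rewrite mevalD => -> ->; rewrite addr0|rewrite mevalM => ->; rewrite mulr0].
split=> [|a b]; first by move=> /eqP; rewrite meval1 oner_eq0.
by rewrite mevalM => /eqP; rewrite mulf_eq0 => /orP[]/eqP; [left|right].
Qed.

Lemma vanishing_maximal v : maximal_ideal (vanishing v).
Proof.
have [VI [V1 _]] := vanishing_prime v; split=> //; split=> // J JI J1 VJ a Ja.
apply: contrapT => /eqP va; apply: J1.
apply: (ideal_scale (k := a.@[v]) JI) => //.
rewrite (_ : _ *: 1 = a - (a - (a.@[v])%:MP)).
  by apply: ideal_sub => //; apply: VJ; rewrite /vanishing mevalB mevalC subrr.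
by rewrite -mul_mpolyC; ring.
Qed.

Lemma maximal_prime M : maximal_ideal M -> prime_ideal M.
Proof.
move=> [MI [M1 Mmax]]; split=> //; split=> // a b Mab.
have [|na] := pselect (M a); first by left.
right; pose J c := exists m d, M m /\ c = m + d * a.
have JI : ideal J.
  split; first by exists 0, 0; rewrite mul0r addr0; split=> //; exact: MI.1.
  split=> [c d [m [e [Mm ->]]] [m' [e' [Mm' ->]]]|c d [m [e [Mm ->]]]].
    by exists (m + m'), (e + e'); split; [exact: MI.2.1|ring].
  by exists (c * m), (c * e); split; [exact: MI.2.2|ring].
have [[m [d [Mm E]]]|J1] := pselect (J 1).
  rewrite -[b]mul1r E mulrDl; apply: MI.2.1; first exact: ideal_mulr.
  by rewrite -mulrA; apply: MI.2.2.
case: na; apply: (Mmax J) => // [c Mc|].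
  by exists c, 0; rewrite mul0r addr0.
by exists 0, 1; rewrite mul1r add0r; split=> //; exact: MI.1.
Qed.

Lemma exists_nonroot (p : {poly K}) : p != 0 -> exists x, ~~ root p x.
Proof.
move=> p0; apply: contrapT => /forallNP H.
have := max_poly_roots (rs := [seq i%:R | i <- iota 0 (size p)]) p0.
rewrite size_map size_iota ltnn => F; suff: false by []; apply: F.
  by apply/allP => x _; apply/negPn/negP/H.
by rewrite map_inj_uniq ?iota_uniq //; exact: (@mulrIn K 1 (oner_neq0 K)).
Qed.

(** Three one-variable steps starting from the field, carried over to [A]. The coordinates of the
    point are the images of the variables. *)
Lemma nullstellensatz P g : prime_ideal P -> ~ P g ->
  exists al be ga, (forall a, P a -> vanishing (pt al be ga) a) /\ ~ vanishing (pt al be ga) g.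
Proof.
move=> PP Pg; have xyz : uniq [:: ix; iy; iz] by [].
have pts3 : enough_points (fun k : K => k%:P%:P%:P).
  have := @enough_points_field K.
  by do 3!move=> /(@enough_points_poly K _ _)/(_ exists_nonroot).
have [q [qC qP qg]] :=
  enough_points_iso (to_nestedK xyz) (of_nestedK xyz) pts3 PP Pg.
exists (q (Px K)), (q (Py K)), (q (Pz K)).
set v := pt _ _ _.
have HC k : q k%:MP = (k%:MP).@[v].
  by rewrite mevalC -(of_nestedC ix iy iz k); exact: qC.
have HX i : q 'X_i = ('X_i).@[v].
  rewrite mevalXU; case: i => [[|[|[|//]]] lt]; rewrite /v /pt /=;
    congr (q 'X_ _); exact: val_inj.
have qE : q =1 meval v.
  exact: (mpoly_rmorph_eq (f := q) (g := GRing.RMorphism.clone A K (meval v) _) HC HX).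
split=> [a /qP|]; first by rewrite /vanishing -qE.
by rewrite /vanishing -qE; apply/eqP.
Qed.

Lemma maximal_point M : maximal_ideal M ->
  exists al be ga, M = vanishing (pt al be ga).
Proof.
move=> MM; have [al [be [ga [MV _]]]] := nullstellensatz (maximal_prime MM) MM.2.1.
exists al, be, ga; apply: eqI_eq => a; split; first exact: MV.
by apply: MM.2.2 => //; [exact: (vanishing_prime _).1|exact: (vanishing_prime _).2.1].
Qed.

End Field.

(** * Locally closed implies primitive, and primitive implies rational *)

Section Main.
Variable K : numClosedFieldType.
Local Notation A := {mpoly K[3]}.
Variables s t : A.
Implicit Types (a b c f g u : A) (I J P Q M : A -> Prop) (lam mu : K).

Lemma point_core (v : 'I_3 -> K) :
  exists2 L, poisson_prime s t L & is_poisson_core s t (vanishing v) L.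
Proof.
(* The brackets with the three coordinates are repeated periodically, so each recurs infinitely
   often. By the Leibniz rule, stability under these three is stability under all brackets. *)
pose gen n := nth (Px K) [:: Px K; Py K; Pz K] (n %% 3).
pose delta n := pbr s t (gen n).
have dP n : derivation (delta n) by exact: pbr_derivation.
have VP := vanishing_prime v.
pose L := core_limit delta (vanishing v).
have LP : ring_prime L by apply: core_limit_prime => //; exact: torsion_free_char0 VP.1.
have inf i m : exists2 n, (m <= n)%N & delta n = delta i.
  exists (m * 3 + i)%N; last by rewrite /delta /gen modnMDl.
  by rewrite (leq_trans _ (leq_addr _ _)) // leq_pmulr.
have LI : poisson_ideal s t L.
  apply: poisson_ideal_gen LP.1 _ _ _ => b.
  - by move=> Lb; exact: (core_limit_stable (i := 0%N) (inf _) Lb).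
  - by move=> Lb; exact: (core_limit_stable (i := 1%N) (inf _) Lb).
  - by move=> Lb; exact: (core_limit_stable (i := 2%N) (inf _) Lb).
exists L => //; split=> //; split=> [a /(_ 0%N)//|J [JI JB] JV].
by apply: core_limit_max => // n a; exact: JB.
Qed.

(** Suppose [a] is in every Poisson prime strictly above [P] but not in [P]. At a point of [P] where
    [a] does not vanish, the core is a Poisson prime containing [P] but not [a], hence it is [P]. *)
Lemma locally_closed_primitive P :
  poisson_prime s t P -> locally_closed s t P -> poisson_primitive s t P.
Proof.
move=> PP Plc; split=> //; apply: contrapT => nprim; apply: Plc => a.
split=> [Pa Q _ PQ _|Qa]; first exact: PQ.
apply: contrapT => nPa.
have [al [be [ga [PV nva]]]] := nullstellensatz PP.2 nPa.
have [L LP Lcore] := point_core (pt al be ga).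
apply: nprim; exists (vanishing (pt al be ga)); split; first exact: vanishing_maximal.
have PL : subI P L by apply: Lcore.2.2 => //; exact: PP.1.
have LsP : subI L P.
  by apply: contrapT => nLP; exact: nva (Lcore.2.1 _ (Qa L LP PL nLP)).
by have -> : P = L by apply: eqI_eq => b; split; [exact: PL|exact: LsP].
Qed.

Definition central_mod P a b := forall c, P (b * pbr s t a c - a * pbr s t b c).

(** The denominators of [a/b] in [A/P]: if [d * (a/b) = e] and [a/b] is central, then
    [{c,d} * (a/b) = {c,e}]. *)
Lemma fraction_ideal_poisson P a b : poisson_prime s t P -> ~ P b ->
  central_mod P a b -> poisson_ideal s t (fun d => exists e, P (d * a - e * b)).
Proof.
move=> [[PI PB] [_ [_ PM]]] nPb ab; split; first split.
- by exists 0; rewrite !mul0r subr0; exact: PI.1.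
- split=> [d d' [e Pe] [e' Pe']|d d' [e Pe]].
    exists (e + e'); rewrite (_ : _ - _ = (d * a - e * b) + (d' * a - e' * b)).
      exact: PI.2.1.
    by ring.
  exists (d * e); rewrite (_ : _ - _ = d * (d' * a - e * b)); last by ring.
  exact: PI.2.2.
move=> c d [e Pe]; exists (pbr s t c e).
have [//|//] : P b \/ P (pbr s t c d * a - pbr s t c e * b).
apply: PM.
have := PB c _ Pe; rewrite pbrBr !pbrMr => /(PI.2.2 b) H.
have := ab c; rewrite [pbr _ _ a c]pbrC [pbr _ _ b c]pbrC => /(PI.2.2 d) H1.
have H2 := PI.2.2 (pbr s t c b) _ Pe.
rewrite (_ : b * _ = b * (pbr s t c d * a + d * pbr s t c a -
   (pbr s t c e * b + e * pbr s t c b)) + d * (b * - pbr s t c a - a * - pbr s t c b)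
   - pbr s t c b * (d * a - e * b)); last by ring.
by apply: ideal_sub => //; apply: PI.2.1.
Qed.

Lemma primitive_rational P : poisson_primitive s t P -> poisson_rational s t P.
Proof.
move=> [PP [M [/maximal_point[al [be [ga ->]]] [PI [PV Pmax]]]]] a b nPb ab.
set v := pt _ _ _ in PV Pmax; have [VI [V1 VM]] := vanishing_prime v.
have PM := PP.2.2.2.
(* If all denominators vanished at the point they would lie in [P], but [b] is one of them. *)
have /existsNP[d /not_implyP[[e de] nd]] :
    ~ subI (fun d => exists e, P (d * a - e * b)) (vanishing v).
  move=> /(Pmax _ (fraction_ideal_poisson PP nPb ab)) H; apply: nPb; apply: H.
  by exists a; rewrite mulrC subrr; exact: PI.1.1.
(* Modulo [P], [a/b] equals [e/d] with [d] nonzero at the point, so [lam] is its value there. *)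
exists (e.@[v] / d.@[v]); set lam := _ / _; set a' := a - _; apply: contrapT => nPa'.
have lamE : vanishing v (e - lam%:MP * d).
  rewrite /vanishing mevalB mevalM mevalC /lam divfK ?subrr //.
  exact/eqP.
(* The inverse [b/a'] is central too. Its denominators are the numerators of [a'/b]; they all vanish
   at the point, hence lie in [P], and [a'] is one of them. *)
have ba' : central_mod P b a'.
  move=> c; rewrite (_ : _ - _ = - (b * pbr s t a c - a * pbr s t b c)).
    by apply: ideal_opp PI.1 _; exact: ab.
  by rewrite /a' pbrBl pbrMl pbr_constl; ring.
have Ppoisson := fraction_ideal_poisson PP nPa' ba'.
apply: nPa'; apply: (Pmax _ Ppoisson).
  move=> g [h gh].
  have [//|] : P b \/ P (d * g - h * (e - lam%:MP * d)).
    apply: PM; rewrite (_ : _ * _ = d * (g * b - h * a') + h * (d * a - e * b)).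
      by apply: PI.1.2.1; apply: PI.1.2.2.
    by rewrite /a'; ring.
  move=> /PV; rewrite addrC => H.
  have : vanishing v (d * g).
    by apply: (ideal_addr VI _ H); apply: ideal_opp => //; apply: VI.2.2.
  by case/VM.
by exists b; rewrite mulrC subrr; exact: PI.1.1.
Qed.

(** * Poisson primes strictly larger than a principal prime *)

Section Curve.
Variables (Q : A -> Prop) (u v : A).
Hypotheses (QP : poisson_prime s t Q) (pu : rprime u) (Qu : Q u) (Qv : Q v).
Hypothesis nuv : ~ rdvd u v.

(* Modulo [Q] the variables [X_a] and [X_b] are algebraically dependent; apply
   the bracket to a dependence relation of minimal degree. *)
Lemma curve_bracket (a b c : 'I_3) (w : A) : uniq [:: a; b; c] ->
  (forall F : A, F^`M(c) = 0 -> pbr s t F 'X_b = F^`M(a) * w) ->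
  (forall F : A, F^`M(c) = 0 -> pbr s t F 'X_a = - (F^`M(b) * w)) -> Q w.
Proof.
move=> abc Hb Ha; have [[QI QB] [_ [Q1 QM]]] := QP.
have [F [F0 Fc [p [q FE]]]] := mpoly3_elimination abc pu nuv.
have QF : Q F by rewrite FE; apply: QI.2.1; apply: QI.2.2.
elim: (msize F) {-2}F (leqnn (msize F)) F0 Fc QF => {p q F FE} [|n IH] F sF F0 Fc QF.
  by move: F0; rewrite -msize_poly_eq0 -leqn0 sF.
have Fac : F^`M(a)^`M(c) = 0 by rewrite mderiv_comm Fc mderiv0.
have Fbc : F^`M(b)^`M(c) = 0 by rewrite mderiv_comm Fc mderiv0.
have descend i : F^`M(i) != 0 -> F^`M(i)^`M(c) = 0 -> Q (F^`M(i) * w) -> Q w.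
  move=> Fi0 Fic /QM[QFi|//]; apply: (IH F^`M(i)) => //.
  by rewrite -ltnS; apply: leq_trans sF; exact: msize_mderiv_lt.
have QFB i : Q (pbr s t F 'X_i) by rewrite pbrC; apply: (ideal_opp QI); exact: QB.
have [Fa0|/descend] := eqVneq F^`M(a) 0; last by apply=> //; rewrite -Hb //; exact: QFB.
have [Fb0|/descend] := eqVneq F^`M(b) 0; last first.
  by apply=> //; rewrite -[_ * w]opprK -Ha //; exact: (ideal_opp QI (QFB a)).
case: Q1; have FC : F = (F@_0)%:MP.
  by apply: mderiv_eq0_const => i; case/or3P: (ord3_cover abc i) => /eqP->.
have k0 : F@_0 != 0 by rewrite -(mpolyC_eq0 3) -FC.
by apply: (ideal_scale QI k0); rewrite -mul_mpolyC mulr1 -FC.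
Qed.

(** Each of the three coordinate brackets is obtained by eliminating the variable that does not
    occur in it. *)
Lemma curve_pbr_in a b : Q (pbr s t a b).
Proof.
have [[xx xy xz] [yx yy yz] [zx zy zz]] := pbr_var s t.
apply: pbr_in QP.1.1 _ _ _ a b.
- apply: (@curve_bracket iy iz ix) => // F Fx; rewrite pbr_expand /dx Fx mul0r add0r.
    by rewrite yz zz mulr0 addr0.
  by rewrite yy zy mulr0 add0r mulrN.
- apply: (@curve_bracket iz ix iy) => // F Fy; rewrite pbr_expand /dy Fy mul0r addr0.
    by rewrite xx zx mulr0 add0r.
  by rewrite xz zz mulr0 addr0 mulrN.
apply: (@curve_bracket ix iy iz) => // F Fz; rewrite pbr_expand /dz Fz mul0r addr0.
  by rewrite xy yy mulr0 addr0.
by rewrite xx yx mulr0 add0r mulrN.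
Qed.

End Curve.

Lemma mdvd_ideal u : ideal (mdvd u).
Proof. by split; [exact: rdvdr0|split; [exact: rdvdD|exact: rdvd_mull]]. Qed.

Lemma mirreducible_prime u : mirreducible u -> rprime u.
Proof. by move=> iu; apply: (@mpoly3_factorial K ix iy iz isT).2. Qed.

(** * Multiple and simple factors of a member of the pencil *)

Section Pencil.
Variables (lam mu : K).
Hypothesis lm : (lam != 0) || (mu != 0).
Let f := lam *: s - mu *: t.

(* [c_i] is recovered, up to a nonzero scalar, from [t f_i - f t_i] or from
   [s f_i - f s_i]. *)
Lemma cross_in I : ideal I -> (forall i, I (t * f^`M(i) - f * t^`M(i))) ->
  (forall i, I (s * f^`M(i) - f * s^`M(i))) -> forall a b, I (pbr s t a b).
Proof.
move=> II It Is.
have [tx ty tz] := cross_t s t lam mu; have [sx sy sz] := cross_s s t lam mu.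
case/orP: lm => k0.
  apply: pbr_in => //; apply: (ideal_scale II k0).
  + by rewrite -tx; exact: It.
  + by rewrite -ty; exact: It.
  by rewrite -tz; exact: It.
apply: pbr_in => //; apply: (ideal_scale II k0).
+ by rewrite -sx; exact: Is.
+ by rewrite -sy; exact: Is.
by rewrite -sz; exact: Is.
Qed.

Lemma in_cross I : ideal I -> (forall a b, I (pbr s t a b)) -> forall i,
  I (t * f^`M(i) - f * t^`M(i)) /\ I (s * f^`M(i) - f * s^`M(i)).
Proof.
move=> II IB; have [Ix Iy Iz] := c_of_pbr IB.
have [tx ty tz] := cross_t s t lam mu; have [sx sy sz] := cross_s s t lam mu.
move=> i; have xyz : uniq [:: ix; iy; iz] by [].
case/or3P: (ord3_cover xyz i) => /eqP->.
- by split; [move: tx|move: sx]; rewrite /cx /dx => ->; exact: ideal_scaler.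
- by split; [move: ty|move: sy]; rewrite /cy /dy => ->; exact: ideal_scaler.
by split; [move: tz|move: sz]; rewrite /cz /dz => ->; exact: ideal_scaler.
Qed.

(** A double factor of [f] divides [f] and all its partial derivatives. *)
Lemma multiple_factor_pbr u a b : mdvd (u * u) f -> mdvd u (pbr s t a b).
Proof.
move=> [q fE]; have uI := mdvd_ideal u.
have fu : mdvd u f by exists (q * u); rewrite fE mulrA.
have dfu i : mdvd u f^`M(i).
  rewrite fE mderivM mderivM; exists (q^`M(i) * u + q * u^`M(i) *+ 2).
  by ring.
by apply: cross_in => // i; apply: ideal_sub => //;
  first [by apply: uI.2.2; exact: dfu | exact: (ideal_mulr _ uI)].
Qed.

Variable u : A.
Hypothesis uf : simple_irr_factor u f.

(** With [f = h * u], divisibility of [{a,f}] by [f] gives that [u] divides [h * {a,u}], and [u]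
    does not divide [h]. *)
Lemma simple_factor_poisson_prime : poisson_prime s t (mdvd u).
Proof.
move: uf => [iu [[h fE] nuu]]; have pu := mirreducible_prime iu.
have uI := mdvd_ideal u; have [u0 [nu uM]] := pu.
have prime_u : prime_ideal (mdvd u) by split=> //; split=> // /rdvd1.
split=> //; split=> // a b [q ->]; rewrite pbrMr; apply: uI.2.1.
  by apply: rdvd_mull; exact: rdvd_refl.
apply: uI.2.2.
have : mdvd u (h * pbr s t a u).
  have [p pE] := pencil_poisson s t a lm; rewrite -/f in pE.
  have : mdvd u (pbr s t a f) by rewrite pE fE; apply/rdvd_mull/rdvd_mull/rdvd_refl.
  rewrite fE pbrMr; apply: (@rdvd_addr _ u); exact/rdvd_mull/rdvd_refl.
case/uM => // -[h' h'E]; case: nuu; exists h'.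
by rewrite fE h'E mulrA.
Qed.

(** Choose [i] such that [u] does not divide its own [i]-th derivative. Modulo [u] the derivative of
    [f] is [h] times that of [u], hence nonzero. If [u] divided all brackets it would divide both
    [t] and [s]. *)
Lemma simple_factor_pbr : mcoprime s t -> ~ forall a b, mdvd u (pbr s t a b).
Proof.
move: uf => [iu [[h fE] nuu]] cop uB; have pu := mirreducible_prime iu.
have uI := mdvd_ideal u; have [u0 [nu uM]] := pu.
have [i ui] := not_rdvd_mderiv u0 nu.
have [ti si] := in_cross uI uB i.
have key g : mdvd u (g * f^`M(i) - f * g^`M(i)) -> mdvd u g.
  rewrite addrC => H; have : rdvd u (g * (h * u^`M(i))).
    have : rdvd u (g * f^`M(i)).
      by apply: (rdvd_addr _ H); apply/rdvdN/rdvd_mulr; exists h.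
    rewrite fE mderivM mulrDr; apply: rdvd_addr.
    by apply/rdvd_mull/rdvd_mull/rdvd_refl.
  case/uM => // /uM[[h' h'E]|//]; case: nuu; exists h'.
  by rewrite fE h'E mulrA.
by apply: nu; apply: (cop u); apply: key.
Qed.

Lemma simple_factor_locally_closed : mcoprime s t -> locally_closed s t (mdvd u).
Proof.
move=> cop H; apply: (simple_factor_pbr cop) => a b; apply/H => Q QP uQ Qu.
have /existsNP[v /not_implyP[Qv nuv]] := Qu.
have pu := mirreducible_prime uf.1.
by apply: (curve_pbr_in QP pu _ Qv nuv); apply: uQ; exact: rdvd_refl.
Qed.

End Pencil.

(** * Classification of the rational Poisson primes and of the Poisson maximal ideals *)

Lemma poisson_maximal_prime M : poisson_maximal s t M -> poisson_prime s t M.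
Proof. by move=> [MM MP]; split=> //; exact: maximal_prime. Qed.

Lemma poisson_maximal_locally_closed M :
  poisson_maximal s t M -> locally_closed s t M.
Proof.
move=> [[MI [M1 Mmax]] MP] H; apply: M1; apply/H => Q QP MQ QM.
by case: QM; apply: Mmax => //; [exact: QP.2.1|exact: QP.2.2.1].
Qed.

(** With zero bracket modulo [P] every fraction [a/1] is central, so each coordinate is congruent to
    a constant. *)
Lemma trivial_rational_maximal P : poisson_prime s t P -> poisson_rational s t P ->
  (forall a b, P (pbr s t a b)) -> poisson_maximal s t P.
Proof.
move=> PP Prat PB; have [PI [P1 _]] := PP.2.
have Pval a : exists k, P (a - k%:MP).
  have [c|k] := Prat a 1 P1.
    by apply: ideal_sub => //; [apply: PI.2.2|apply: PI.2.2].
  by rewrite mulr1; exists k.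
have [al Pal] := Pval (Px K); have [be Pbe] := Pval (Py K); have [ga Pga] := Pval (Pz K).
have ptP a : pt_ideal al be ga a -> P a.
  move=> [q1 [q2 [q3 ->]]].
  by apply: PI.2.1; [apply: PI.2.1|]; apply: PI.2.2.
have max_pt := vanishing_maximal (pt al be ga); rewrite -pt_idealE in max_pt.
have PE : P = pt_ideal al be ga.
  by apply: eqI_eq => a; split; [exact: max_pt.2.2|exact: ptP].
by split; [rewrite PE|exact: PP.1].
Qed.

(** If [t] is in [P], the pair (0, 1) works. Otherwise the central fraction [s/t] is a constant [k]
    modulo [P], so [s - k t] is in [P]. *)
Lemma rational_pencil P : poisson_prime s t P -> poisson_rational s t P ->
  exists lam mu, ((lam != 0) || (mu != 0)) /\ P (lam *: s - mu *: t).
Proof.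
move=> PP Prat; have PI := PP.1.1; have [Pt|nPt] := pselect (P t).
  exists 0, 1; rewrite oner_neq0 orbT scale0r scale1r sub0r; split=> //.
  exact: ideal_opp.
have [c|k Pk] := Prat s t nPt.
  rewrite (_ : _ - _ = 0); first exact: PI.1.
  by rewrite /pbr /cx /cy /cz; ring.
by exists 1, k; rewrite oner_neq0 scale1r -mul_mpolyC.
Qed.

Lemma irreducible_factor_in P f : prime_ideal P -> P f -> f != 0 ->
  exists u, [/\ mirreducible u, mdvd u f & P u].
Proof.
move=> [PI [P1 PM]] Pf f0.
move: f f0 Pf; apply: (factorial_ind (mpoly3_factorial K (isT : uniq [:: ix; iy; iz])))
  => [a [b ab]|p a pp a0 IH].
  by move=> Pa; case: P1; rewrite -ab; exact: ideal_mulr.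
case/PM => [Pp|/IH[u [iu ua Pu]]].
  by exists p; split=> //; [exact: rprime_irreducible|apply/rdvd_mulr/rdvd_refl].
by exists u; split=> //; exact: rdvd_mull.
Qed.

Definition type_ii P := exists lam mu, ((lam != 0) || (mu != 0)) /\
  lam *: s - mu *: t != 0 /\ ~ munit (lam *: s - mu *: t) /\
  exists u, simple_irr_factor u (lam *: s - mu *: t) /\ eqI P (mdvd u).

Lemma rational_classified P : poisson_prime s t P -> poisson_rational s t P ->
  poisson_maximal s t P \/ type_ii P.
Proof.
move=> PP Prat; have [lam [mu [lm Pf]]] := rational_pencil PP Prat.
set f := _ - _ in Pf; have [PI [P1 PM]] := PP.2.
have triv := trivial_rational_maximal PP Prat.
have [f0|f0] := eqVneq f 0.
  left; apply: triv; apply: (cross_in lm) => // i; rewrite -/f f0 mderiv0 mulr0 mul0r subr0;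
  exact: PI.1.
have nuf : ~ munit f.
  by move=> [g fg]; apply: P1; rewrite -fg; exact: ideal_mulr.
have [u [iu uf Pu]] := irreducible_factor_in PP.2 Pf f0.
have uP a : mdvd u a -> P a by move=> [q ->]; apply: PI.2.2.
have [uuf|nuuf] := pselect (mdvd (u * u) f).
  by left; apply: triv => a b; apply: uP; exact: (multiple_factor_pbr lm).
have [Psub|/existsNP[v /not_implyP[Pv nuv]]] := pselect (subI P (mdvd u)).
  right; exists lam, mu; do 3!split=> //; exists u; split=> // a.
  by split; [exact: Psub|exact: uP].
by left; apply: triv => a b; apply: (curve_pbr_in PP (mirreducible_prime iu) Pu Pv nuv).
Qed.

Lemma classified_locally_closed P : mcoprime s t ->
  poisson_maximal s t P \/ type_ii P -> poisson_prime s t P /\ locally_closed s t P.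
Proof.
move=> cop [PM|[lam [mu [lm [_ [_ [u [uf /eqI_eq ->]]]]]]]].
  by split; [exact: poisson_maximal_prime|exact: poisson_maximal_locally_closed].
split; first exact: (simple_factor_poisson_prime lm uf).
exact: (simple_factor_locally_closed uf).
Qed.

(** Brackets kill constants, so [b] may be replaced by [b] minus its value at the point, which lies
    in the ideal. *)
Lemma poisson_maximal_pbr al be ga : poisson_ideal s t (pt_ideal al be ga) <->
  forall a b, vanishing (pt al be ga) (pbr s t a b).
Proof.
rewrite pt_idealE; set v := pt _ _ _; have [VI _] := vanishing_prime v.
split=> [[_ VB] a b|VB]; last by split.
rewrite (_ : pbr s t a b = pbr s t a (b - (b.@[v])%:MP)); last first.
  by rewrite pbrBr pbr_constr subr0.
by apply: VB; rewrite /vanishing mevalB mevalC subrr.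
Qed.

Lemma poisson_maximal_points M : poisson_maximal s t M <->
  exists al be ga, eqI M (pt_ideal al be ga) /\
    ((s.@[pt al be ga] = 0 /\ t.@[pt al be ga] = 0) \/
     exists lam mu, ((lam != 0) || (mu != 0)) /\
       is_singular_point (lam *: s - mu *: t) al be ga).
Proof.
split=> [[MM MP]|[al [be [ga [/eqI_eq -> H]]]]]; last first.
  split; first by rewrite pt_idealE; exact: vanishing_maximal.
  apply/poisson_maximal_pbr; have [VI _] := vanishing_prime (pt al be ga).
  case: H => [[s0 t0]|[lam [mu [lm [f0 [fx [fy fz]]]]]]].
    apply: pbr_in => //;
      by rewrite /vanishing /cx /cy /cz mevalB !mevalM s0 t0 !mul0r subrr.
  have df0 i : ((lam *: s - mu *: t)^`M(i)).@[pt al be ga] = 0.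
    have xyz : uniq [:: ix; iy; iz] by [].
    by case/or3P: (ord3_cover xyz i) => /eqP->.
  by apply: (cross_in lm) => // i;
    rewrite /vanishing mevalB !mevalM f0 df0 mulr0 mul0r subrr.
have [al [be [ga ME]]] := maximal_point MM; exists al, be, ga.
rewrite -pt_idealE in ME; rewrite ME in MP *; split=> //.
have /c_of_pbr[] := (poisson_maximal_pbr al be ga).1 MP; set v := pt _ _ _.
rewrite /vanishing /cx /cy /cz !mevalB !mevalM => cx0 cy0 cz0.
have [/andP[/eqP s0 /eqP t0]|nst] := boolP ((s.@[v] == 0) && (t.@[v] == 0)); first by left.
(* For the member [t(p) s - s(p) t] of the pencil, the value at [p] is zero and the gradient at [p]
   is [c(p)], which vanishes. *)
right; exists t.@[v], s.@[v]; split; first by rewrite orbC -negb_and.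
rewrite /is_singular_point -/v /dx /dy /dz !mderivB !mderivZ !mevalB !mevalZ.
by rewrite [t.@[v] * s.@[v]]mulrC subrr.
Qed.

End Main.

Theorem theorem3p7 (R : realType) (s t : {mpoly (complex R)[3]}) :
  s != 0 -> t != 0 -> mcoprime s t ->
  (* (i) description of the Poisson maximal ideals *)
  (forall M : {mpoly (complex R)[3]} -> Prop,
     poisson_maximal s t M <->
     exists al be ga : complex R,
       eqI M (pt_ideal al be ga) /\
       ((s.@[pt al be ga] = 0 /\ t.@[pt al be ga] = 0) \/
        exists lam mu : complex R, ((lam != 0) || (mu != 0)) /\
          is_singular_point (lam *: s - mu *: t) al be ga)) /\
  (* the Poisson primitive ideals are exactly (i) and (ii) *)
  (forall P : {mpoly (complex R)[3]} -> Prop,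
     poisson_primitive s t P <->
     (poisson_maximal s t P \/
      exists lam mu : complex R, ((lam != 0) || (mu != 0)) /\
        lam *: s - mu *: t != 0 /\ ~ munit (lam *: s - mu *: t) /\
        exists u : {mpoly (complex R)[3]},
          simple_irr_factor u (lam *: s - mu *: t) /\ eqI P (mdvd u))) /\
  (* Poisson Dixmier-Moeglin equivalence *)
  (forall P : {mpoly (complex R)[3]} -> Prop, poisson_prime s t P ->
     (locally_closed s t P <-> poisson_primitive s t P) /\
     (poisson_primitive s t P <-> poisson_rational s t P)).
Proof.
move=> _ _ cop; pose K : numClosedFieldType := complex R.
have classified P : poisson_prime s t P -> poisson_rational s t P ->
    poisson_maximal s t P \/ type_ii (K := K) s t P by exact: (@rational_classified K).
have lclosed P : poisson_maximal s t P \/ type_ii (K := K) s t P ->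
    poisson_prime s t P /\ locally_closed s t P.
  exact: (@classified_locally_closed K).
have prim P : poisson_prime s t P -> locally_closed s t P -> poisson_primitive s t P.
  exact: (@locally_closed_primitive K).
have rat P : poisson_primitive s t P -> poisson_rational s t P.
  exact: (@primitive_rational K).
(* Primitive, rational, of type (i) or (ii), locally closed, primitive again: this closed cycle
   gives both the classification and the equivalence. *)
split; first exact: (@poisson_maximal_points K).
split=> [P|P PP].
  split=> [Pp|/lclosed[PP Pl]]; last exact: prim.
  exact: classified Pp.1 (rat _ Pp).
split; split; [exact: prim| |exact: rat|].
- by move=> Pp; have [] := lclosed _ (classified _ PP (rat _ Pp)).
by move=> Pr; have [_] := lclosed _ (classified _ PP Pr); exact: prim.
Qed.
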